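(* Let $(K,\nu)$ be a henselian valued field with $\operatorname{char} K\nu=p>0$. Let $(L|K,\nu)$ be a separable nontrivial purely wild extension and $(F|K,\nu)$ a nontrivial tame extension. Suppose that $(E|K,\nu)$ is an abelian Galois tame extension such that $L.E|K$ and $F.E|K$ are Galois extensions. Further suppose that the following conditions are satisfied: (1) $\theta:\operatorname{Gal}(F.E|K)\to\operatorname{Gal}(L.E|K)$ is a continuous isomorphism; (2) the restriction $\theta_{\mathrm{res}}:\operatorname{Gal}(F.E|E)\to\operatorname{Gal}(L.E|E)$ of $\theta$ is a continuous isomorphism. Let $(L.E|K)^{\mathrm{ab}}$ denote the maximal abelian Galois subextension of $L.E|K$. Then the following cases are possible: (a) $E\subsetneq (L.E|K)^{\mathrm{ab}}$. Then $(K,\nu)$ does not admit a unique maximal purely wild extension. (b) $E=(L.E|K)^{\mathrm{ab}}$. Then $(E,\nu)$ does not admit a unique maximal purely wild extension.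
   Context: Valuations are Krull valuations of arbitrary rank, written additively. $\nu K$ is the value group and $K\nu$ the residue field of $(K,\nu)$. $(K,\nu)$ is henselian if $\nu$ extends uniquely to the algebraic closure $K^{\mathrm{ac}}$; every algebraic extension of $K$ is taken inside $K^{\mathrm{ac}}$ and carries this unique extension, again denoted $\nu$. $L.E$ denotes the compositum of $L$ and $E$. Algebraic extensions may be infinite, and Galois groups carry the Krull topology. For henselian $(K,\nu)$ with $\operatorname{char}K\nu=p>0$, an algebraic extension $(L|K,\nu)$ is purely wild if $\nu L/\nu K$ is a $p$-group and $L\nu|K\nu$ is purely inseparable. An algebraic extension $(L|K,\nu)$ is tame if every finite subextension $(E'|K,\nu)$ satisfies: $\operatorname{char}K\nu$ does not divide $[\nu E':\nu K]$; $E'\nu|K\nu$ is separable; and $[E':K]=[\nu E':\nu K][E'\nu:K\nu]$. A maximal purely wild extension of $K$ is a purely wild extension inside $K^{\mathrm{ac}}$ not properly contained in another purely wild extension of $K$. ''$(K,\nu)$ does not admit a unique maximal purely wild extension'' means that there exist two maximal purely wild extensions of $(K,\nu)$ that are not isomorphic over $K$ by a valuation preserving isomorphism; likewise for $(E,\nu)$, over $E$. *)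

(* Defs.v *)
From HB Require Import structures.
From mathcomp Require Import all_boot all_order all_algebra.
From mathcomp Require Import generic_quotient ring_quotient.
From mathcomp Require Import separable.
From mathcomp Require Import all_classical.

Set Implicit Arguments.
Unset Strict Implicit.
Unset Printing Implicit Defensive.

Import Order.TTheory GRing.Theory Num.Theory.

Local Open Scope classical_set_scope.
Local Open Scope ring_scope.
Local Open Scope quotient_scope.

(* A Krull valuation, as a map on the nonzero elements with values in a totally
   ordered abelian group.  The value "infinity" of 0 is left out of the group:
   [vfun v 0] is a junk value, on which nothing below depends.  The map need
   not be surjective; value groups are the images [value_group]. *)
Record valuation (R : fieldType) := Valuation {
  vgroup : porderZmodType;
  vfun :> R -> vgroup;
  vgroup_total : forall g h : vgroup, (g <= h) || (h <= g);
  vgroup_leD2l : forall g h k : vgroup, h <= k -> g + h <= g + k;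
  valM : forall x y : R, x != 0 -> y != 0 -> vfun (x * y) = vfun x + vfun y;
  valD : forall x y : R, x != 0 -> y != 0 -> x + y != 0 ->
    (vfun x <= vfun (x + y)) || (vfun y <= vfun (x + y))
}.

Section Residue.
Variables (R : fieldType) (v : valuation R).
Implicit Types x y : R.

Definition vring : {pred R} := fun x => (x == 0) || (0 <= v x).

Lemma vgroup_leD2 (g h k l : vgroup v) : g <= h -> k <= l -> g + k <= h + l.
Proof.
move=> gh kl; apply: (le_trans (vgroup_leD2l g kl)).
by rewrite ![_ + l]addrC vgroup_leD2l.
Qed.

Lemma val1 : v 1 = 0.
Proof. by apply: (@addrI _ (v 1)); rewrite -valM ?oner_neq0// mulr1 addr0. Qed.

Lemma valN x : x != 0 -> v (- x) = v x.
Proof.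
have N1 : -1 != 0 :> R by rewrite oppr_eq0 oner_neq0.
have e : v (-1) + v (-1) = 0 by rewrite -valM// mulrNN mulr1 val1.
suff vN1 : v (-1) = 0 by move=> x0; rewrite -mulN1r valM// vN1 add0r.
case/orP: (vgroup_total 0 (v (-1))) => h; apply/le_anti; rewrite h ?andbT /=;
  by have := vgroup_leD2l (v (-1)) h; rewrite addr0 e.
Qed.

Lemma valV x : x != 0 -> v x^-1 = - v x.
Proof.
move=> x0; apply: (@addrI _ (v x)).
by rewrite -valM ?invr_eq0// mulfV// val1 subrr.
Qed.

Lemma vring_subring_closed : subring_closed vring.
Proof.
rewrite /vring; split => [|x y|x y]; rewrite !unfold_in.
- by rewrite val1 lexx orbT.
- have [->|x0] := eqVneq x 0.
    have [->|y0] := eqVneq y 0; first by rewrite subrr eqxx.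
    by rewrite sub0r oppr_eq0 valN// (negPf y0).
  have [->|y0] := eqVneq y 0; first by rewrite subr0 (negPf x0) /= => ->.
  move=> /= vx vy; have [//|xy0] := eqVneq (x - y) 0 => /=.
  have Ny0 : - y != 0 by rewrite oppr_eq0.
  by case/orP: (valD v x0 Ny0 xy0); rewrite ?valN//; apply: le_trans.
- have [->|x0] := eqVneq x 0; first by rewrite mul0r eqxx.
  have [->|y0] := eqVneq y 0; first by rewrite mulr0 eqxx.
  by move=> /= vx vy; rewrite valM// -[X in X <= _]addr0 vgroup_leD2 ?orbT.
Qed.

HB.instance Definition _ :=
  GRing.isSubringClosed.Build R vring vring_subring_closed.

Record vring_of := VringOf { vring_val : R; _ : vring_val \in vring }.

HB.instance Definition _ := [isSub for vring_val].
HB.instance Definition _ := [Choice of vring_of by <:].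
HB.instance Definition _ := [SubChoice_isSubComNzRing of vring_of by <:].

Let vpos (x : R) := (x == 0) || (0 < v x).

Let vposM (a x : R) : a \in vring -> vpos x -> vpos (a * x).
Proof.
rewrite unfold_in /vpos.
have [->|a0] := eqVneq a 0; first by rewrite mul0r eqxx.
have [->|x0] := eqVneq x 0; first by rewrite mulr0 eqxx.
rewrite (negPf (mulf_neq0 a0 x0)) /= valM// => va vx.
by rewrite (lt_le_trans vx)// -[X in X <= _]add0r vgroup_leD2.
Qed.

Let vposD (x y : R) : vpos x -> vpos y -> vpos (x + y).
Proof.
rewrite /vpos; have [->|x0] := eqVneq x 0; first by rewrite add0r.
have [->|y0] := eqVneq y 0; first by rewrite addr0 (negPf x0).
have [//|s0] := eqVneq (x + y) 0 => /= vx vy.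
by case/orP: (valD v x0 y0 s0); apply: lt_le_trans.
Qed.

Definition vmax : {pred vring_of} :=
  fun x : vring_of => (val x == 0) || (0 < v (val x)).

Lemma vmax_idealr_closed : idealr_closed vmax.
Proof.
split=> [||a x y]; rewrite !unfold_in /vmax.
- by rewrite raddf0 eqxx.
- by rewrite rmorph1 oner_eq0 val1 ltxx.
by move=> hx hy; apply: vposD => //; apply: vposM => //; apply: valP.
Qed.

HB.instance Definition _ := isIdealr.Build vring_of vmax vmax_idealr_closed.

Definition residue := {ideal_quot vmax}.
HB.instance Definition _ := GRing.ComNzRing.on residue.
HB.instance Definition _ := EqQuotient.on residue.

Definition res (x : vring_of) : residue := \pi_residue x.

Lemma res_eq0 (x : vring_of) : (res x == 0) = (x \in vmax).
Proof. by rewrite /res -[0](rmorph0 \pi_residue) eqmodE /= Quotient.equivE subr0. Qed.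

Lemma resM (x y : vring_of) : res (x * y) = res x * res y.
Proof. exact: rmorphM. Qed.

Lemma vunit_inv (x : vring_of) : x \notin vmax -> (val x)^-1 \in vring.
Proof.
rewrite !unfold_in /vmax negb_or => /andP[x0 vx0].
have := valP x; rewrite unfold_in (negPf x0) /= le_eqVlt (negPf vx0) orbF.
by move=> /eqP vx; rewrite valV// -vx oppr0 lexx orbT.
Qed.

Definition residue_inv (r : residue) : residue :=
  if r == 0 then 0 else res (insubd 0 (val (repr r))^-1).

Lemma residue_mulVf r : r != 0 -> residue_inv r * r = 1.
Proof.
move=> r0; rewrite /residue_inv (negPf r0); set x := repr r.
have rE : r = res x by rewrite /res reprK.
have xm : x \notin vmax by rewrite -res_eq0 -rE.
have x0 : val x != 0.
  by apply: contraNneq xm => e; rewrite unfold_in /vmax e eqxx.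
rewrite [X in _ * X]rE -resM; apply/eqP; rewrite -subr_eq0; apply/eqP.
have -> : insubd 0 (val x)^-1 * x = 1 :> vring_of.
  by apply: val_inj; rewrite rmorphM rmorph1 /= insubdK ?vunit_inv// mulVf.
by rewrite /res rmorph1 subrr.
Qed.

Lemma residue_inv0 : residue_inv 0 = 0.
Proof. by rewrite /residue_inv eqxx. Qed.

HB.instance Definition _ :=
  GRing.ComNzRing_isField.Build residue residue_mulVf residue_inv0.

End Residue.

Arguments res {R} v x.

Section Subfields.
Variable C : fieldType.
Implicit Types (A B M S : set C) (x y : C) (p q : {poly C}).

Definition subfield S :=
  [/\ S 1, forall x y, S x -> S y -> S (x - y)
    & forall x y, S x -> S y -> S (x / y)].

Definition extension A B := [/\ subfield A, subfield B & A `<=` B].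

Definition compositum A B := smallest subfield (A `|` B).

Definition coefs_in A p := forall i, A p`_i.

Definition algebraic_element A x := exists p, [/\ coefs_in A p, p != 0 & root p x].

Definition is_minpoly A x p :=
  [/\ p \is monic, coefs_in A p, root p x
    & forall q, coefs_in A q -> q != 0 -> root q x -> (size p <= size q)%N].

Definition separable_element A x :=
  exists p, is_minpoly A x p /\ separable_poly p.

Definition separable_extension A B := forall x, B x -> separable_element A x.

Definition purely_inseparable_extension A B :=
  forall x, B x -> exists2 n : nat, [pchar C].-nat n & A (x ^+ n).

(* [B : A] = n, witnessed by a basis. *)
Definition degree A B n :=
  exists2 b : 'I_n -> C, (forall i, B (b i))
    & forall x, B x -> exists! c : {ffun 'I_n -> C},
        (forall i, A (c i)) /\ x = \sum_i c i * b i.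

Definition finite_extension A B := exists n, degree A B n.

End Subfields.

(* [H : G] = n for subgroups G of H, witnessed by coset representatives. *)
Definition group_index (V : zmodType) (G H : set V) (n : nat) :=
  exists2 t : 'I_n -> V, (forall i, H (t i))
    & forall h, H h -> exists! i, G (h - t i).

(* From here on, all fields are subfields of a fixed algebraically closed one. *)
Section GaloisTheory.
Variable C : closedFieldType.
Implicit Types (A B D M : set C) (s t : C -> C) (U : set (C -> C)).

Definition normal_extension A B :=
  forall x p, B x -> is_minpoly A x p -> forall y, root p y -> B y.

Definition galois_extension A B :=
  [/\ extension A B, separable_extension A B & normal_extension A B].

Definition field_hom_on B s :=
  [/\ s 1 = 1, forall x y, B x -> B y -> s (x + y) = s x + s y
    & forall x y, B x -> B y -> s (x * y) = s x * s y].

(* Gal(B | A).  An automorphism of B is represented by the unique function on C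
   that extends it by the identity outside B, so that the group law is the
   composition of functions, and Gal(B | M) is a subset of Gal(B | A) for every
   intermediate field M. *)
Definition gal A B : set (C -> C) :=
  [set s | [/\ set_bij B B s, field_hom_on B s, forall x, A x -> s x = x
             & forall x, ~ B x -> s x = x]].

Definition abelian_galois A B :=
  galois_extension A B
  /\ forall s t, gal A B s -> gal A B t -> s \o t = t \o s.

(* D is the maximal abelian Galois subextension of B | A. *)
Definition max_abelian A B D :=
  [/\ abelian_galois A D, D `<=` B
    & forall M, abelian_galois A M -> M `<=` B -> M `<=` D].

(* The open sets of the Krull topology: the cosets of the groups Gal(B | M),
   with M | A a finite Galois subextension of B | A, are a basis. *)
Definition krull_open A B U :=
  U `<=` gal A B /\
  forall s, U s -> exists M,
    [/\ galois_extension A M, M `<=` B, finite_extension A M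
      & forall t, gal M B t -> U (s \o t)].

(* The restriction of th to Gal(B | A) is a continuous isomorphism onto
   Gal(D | A); the values of th elsewhere are irrelevant. *)
Definition continuous_gal_iso A B D (th : (C -> C) -> C -> C) :=
  [/\ set_bij (gal A B) (gal A D) th,
      forall s t, gal A B s -> gal A B t -> th (s \o t) = th s \o th t
    & forall U, krull_open A D U -> krull_open A B (gal A B `&` th @^-1` U)].

End GaloisTheory.

Section ValuedFields.
Variables (C : closedFieldType) (v : valuation C).
Implicit Types (A B K L M W : set C).

Definition value_group A : set (vgroup v) :=
  [set v x | x in [set x | A x /\ x != 0]].

(* The residue field of (A, v), inside the residue field of (C, v). *)
Definition residue_field A : set (residue v) :=
  res v @` [set x | A (val x)].

Definition is_algebraic_closure K :=
  subfield K /\ forall x, algebraic_element K x.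

(* (K, v) is henselian: two valuations are identified when they have the same
   valuation ring, and w extends v|K when both have the same trace on K. *)
Definition henselian K :=
  is_algebraic_closure K /\
  forall w : valuation C,
    (forall x, K x -> (x \in vring w) = (x \in vring v)) -> vring w =i vring v.

(* Here and below, p is the residue characteristic. *)
Definition purely_wild (p : nat) K L :=
  [/\ extension K L,
      forall g, value_group L g -> exists n : nat, value_group K (g *+ (p ^ n))
    & purely_inseparable_extension (residue_field K) (residue_field L)].

Definition tame (p : nat) K L :=
  extension K L /\
  forall M, extension K M -> M `<=` L -> finite_extension K M ->
    separable_extension (residue_field K) (residue_field M) /\
    exists e f : nat,
      [/\ group_index (value_group K) (value_group M) e,
          degree (residue_field K) (residue_field M) f,
          ~~ (p %| e)%N & degree K M (e * f)].

Definition max_purely_wild (p : nat) K W :=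
  purely_wild p K W /\
  forall W', purely_wild p K W' -> W `<=` W' -> W' = W.

Definition valued_isomorphic K L M :=
  exists s : C -> C,
    [/\ set_bij L M s, field_hom_on L s, forall x, K x -> s x = x
      & forall x, L x -> x != 0 -> v (s x) = v x].

Definition not_unique_max_purely_wild (p : nat) K :=
  exists W W', [/\ max_purely_wild p K W, max_purely_wild p K W'
                & ~ valued_isomorphic K W W'].

End ValuedFields.

(* Main.v *)
(* The two cases have a common core. Let B be henselian, with absolute Galois
   group G, let M|B be Galois of degree p and purely wild, and F0|B Galois of
   degree p and tame. M.F0 contains a third Galois extension M'|B of degree p,
   again purely wild, with M.M' = M.F0. A maximal purely wild extension
   containing M is not isomorphic over B to one containing M': since M is
   Galois, the latter would contain M and M', hence F0. This is applied with
   B = K in case (a), where L meets the abelian extension (L.E|K)^ab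
   non-trivially, and with B = E in case (b). M is found inside L.E, as a purely
   wild Galois extension has a pro-p group, and F0 corresponds to M under theta.

   "Wild" and "tame" are handled through [graded g x], i.e. v(g x - x) > v(x):
   purely wild extensions are those on which all of G acts in this way, and on
   a tame extension only the identity does. Linear disjointness and Galois
   descent for this notion both come from a valued version of Dedekind's lemma
   on the independence of characters ([graded_dedekind]). *)
From HB Require Import structures.
From mathcomp Require Import all_boot all_order all_algebra.
From mathcomp Require Import all_fingroup all_solvable.
From mathcomp Require Import separable.
From mathcomp Require Import ring.
From mathcomp Require Import all_classical.
Require Import Defs.

Set Implicit Arguments.
Unset Strict Implicit.
Unset Printing Implicit Defensive.

Import Order.TTheory GRing.Theory Num.Theory.

Local Open Scope classical_set_scope.
Local Open Scope ring_scope.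

(** * Subfields and extension of isomorphisms *)

(** [B] may be imperfect, so an element fixed by all automorphisms over [B] need not lie in [B];
    only some p-power of it does. Passages from fixed to rational elements are therefore made up to
    such a power, which costs nothing because [graded g (x ^+ (p ^ k))] implies [graded g x]. The
    extensions may be infinite: Galois groups are seen through their permutations of finite lists
    stable under conjugation, and continuity of [theta] is what supplies such a list for F0.
    Extensions of degree p are given by homomorphisms from the absolute Galois group onto a group of
    order p, so that M' belongs to the quotient of the characters of M and F0. The reason why M' is
    purely wild: some automorphism fixes F0 and moves M. It still acts trivially on the leading
    terms of M.F0, and it generates Gal(M'|B). The norm of an element of M' is then a product of p
    conjugates with the same leading term, so p times its value and the p-th power of its residue
    come from B, up to p-powers. *)

Lemma exprB_pchar (R : comNzRingType) (x y : R) n :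
  [pchar R].-nat n -> (x - y) ^+ n = x ^+ n - y ^+ n.
Proof. by move=> hn; rewrite -[x in RHS](subrK y) (exprDn_pchar (x - y) y hn) addrK. Qed.

Section SubfieldType.
Variable C : fieldType.
Implicit Types A B : set C.

Definition subfield_pred A (hA : subfield A) : {pred C} := fun x => `[<A x>].

Lemma subfield_pred_closed A (hA : subfield A) :
  divring_closed (subfield_pred hA).
Proof.
case: (hA) => h1 hB hV; split; first by apply/asboolP.
- by move=> x y /asboolP Ax /asboolP Ay; apply/asboolP; apply: hB.
by move=> x y /asboolP Ax /asboolP Ay; apply/asboolP; apply: hV.
Qed.

HB.instance Definition _ A (hA : subfield A) :=
  GRing.isDivringClosed.Build C (subfield_pred hA) (subfield_pred_closed hA).

(** A set-theoretic subfield as a [fieldType], so that polynomial division, Bezout relations and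
    matrix ranks can be used over it. *)
Record subfield_of A (hA : subfield A) :=
  SubfieldOf { sfval : C; _ : sfval \in subfield_pred hA }.

HB.instance Definition _ A (hA : subfield A) := [isSub for @sfval A hA].
HB.instance Definition _ A (hA : subfield A) :=
  [Choice of subfield_of hA by <:].
HB.instance Definition _ A (hA : subfield A) :=
  [SubChoice_isSubIntegralDomain of subfield_of hA by <:].
HB.instance Definition _ A (hA : subfield A) :=
  [SubIntegralDomain_isSubField of subfield_of hA by <:].

Section Closure.
Variables (A : set C) (hA : subfield A).

Lemma subfield1 : A 1. Proof. by case: hA. Qed.

Lemma subfieldB x y : A x -> A y -> A (x - y).
Proof. by case: hA => _ h _; apply: h. Qed.

Lemma subfield_div x y : A x -> A y -> A (x / y).
Proof. by case: hA => _ _; apply. Qed.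

Lemma subfield0 : A 0.
Proof. by rewrite -(subrr 1); apply: subfieldB; apply: subfield1. Qed.

Lemma subfieldN x : A x -> A (- x).
Proof. by rewrite -sub0r; apply: subfieldB; apply: subfield0. Qed.

Lemma subfieldD x y : A x -> A y -> A (x + y).
Proof. by move=> Ax Ay; rewrite -[y]opprK; apply/subfieldB/subfieldN. Qed.

Lemma subfieldV x : A x -> A x^-1.
Proof. by rewrite -div1r; apply: subfield_div; apply: subfield1. Qed.

Lemma subfieldM x y : A x -> A y -> A (x * y).
Proof. by move=> Ax Ay; rewrite -[y]invrK; apply/subfield_div/subfieldV. Qed.

Lemma subfieldX x n : A x -> A (x ^+ n).
Proof.
by move=> Ax; elim: n => [|n IH]; rewrite ?exprS; [apply: subfield1 | apply: subfieldM].
Qed.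

Lemma subfield_sum (I : Type) (r : seq I) (P : pred I) (f : I -> C) :
  (forall i, P i -> A (f i)) -> A (\sum_(i <- r | P i) f i).
Proof. by move=> h; elim/big_ind: _ => //; [apply: subfield0 | apply: subfieldD]. Qed.

Lemma subfield_nat n : A n%:R.
Proof.
elim: n => [|n IH]; first exact: subfield0.
by rewrite -addn1 natrD; apply: subfieldD IH subfield1.
Qed.

Lemma coefs_in_horner p x : coefs_in A p -> A x -> A p.[x].
Proof.
move=> hp Ax; rewrite horner_coef; apply: subfield_sum => i _.
by apply: subfieldM; [apply: hp | apply: subfieldX].
Qed.

Let F := subfield_of hA.

Lemma sfvalP (a : F) : A (val a).
Proof. exact/asboolP/(valP a). Qed.

Lemma sfval_lift x : A x -> exists a : F, val a = x.
Proof. by move=> /asboolP Ax; exists (SubfieldOf (hA := hA) Ax). Qed.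

Lemma coefs_in_map (p : {poly F}) : coefs_in A (map_poly val p).
Proof. by move=> i; rewrite coef_map; apply: sfvalP. Qed.

Lemma coefs_in_lift p : coefs_in A p -> exists q : {poly F}, map_poly val q = p.
Proof.
move=> hp; have [c hc] := choice (fun i => sfval_lift (hp i)).
exists (\poly_(i < size p) c i); apply/polyP => i; rewrite coef_map coef_poly /=.
by case: ltnP => hi; [apply: hc | rewrite nth_default].
Qed.

Lemma minpoly_exists x : algebraic_element A x -> exists p, is_minpoly A x p.
Proof.
case=> p0 [cp0 p0n rp0].
pose P n := `[<exists p, [/\ coefs_in A p, p != 0, root p x & size p = n]>].
have exP : exists n, P n by exists (size p0); apply/asboolP; exists p0.
case: (ex_minnP exP) => n /asboolP [p [cp pn rp sp]] hn.
have lp : lead_coef p != 0 by rewrite lead_coef_eq0.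
exists ((lead_coef p)^-1 *: p); split.
- by rewrite monicE lead_coefZ mulVf.
- by move=> i; rewrite coefZ; apply: subfieldM (cp i); apply/subfieldV/cp.
- by rewrite rootZ // invr_eq0.
move=> q cq qn rq; rewrite size_scale ?invr_eq0 // sp; apply: hn.
by apply/asboolP; exists q.
Qed.

Lemma minpoly_lift x p : is_minpoly A x p -> exists q : {poly F},
  [/\ map_poly val q = p, q != 0 &
      forall r : {poly F}, root (map_poly val r) x = (q %| r)].
Proof.
case=> mp cp rp hmin; have [q qp] := coefs_in_lift cp.
have pn : p != 0 by apply: monic_neq0.
have qn : q != 0 by rewrite -(map_poly_eq0 (val : {rmorphism F -> C})) qp.
exists q; split=> // r; apply/idP/idP => [rr|/dvdpP [u ->]]; last first.
  by rewrite rmorphM /= rootM qp rp orbT.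
rewrite /dvdp; have [//|m0] := eqVneq (r %% q) 0.
suff : (size q <= size (r %% q)%R)%N by rewrite leqNgt ltn_modp qn.
rewrite -(size_map_poly (val : {rmorphism F -> C}) q).
rewrite -(size_map_poly (val : {rmorphism F -> C}) (r %% q)) qp.
apply: hmin; [exact: coefs_in_map | by rewrite map_poly_eq0 |].
move: rr; rewrite {1}(divp_eq r q) rmorphD rmorphM /= qp /root.
by rewrite hornerD hornerM (eqP rp) mulr0 add0r.
Qed.

(** The hypotheses make [q] irreducible: it generates the prime ideal of the polynomials vanishing
    at [x]. In q = e d, with d the gcd, either e vanishes at [x], so [q] divides e and d is
    constant, or d does, so [q] divides d and hence [r]. *)
Lemma minpoly_coprime x (q r : {poly F}) : q != 0 ->
  (forall r : {poly F}, root (map_poly val r) x = (q %| r)) ->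
  ~~ root (map_poly val r) x -> coprimep q r.
Proof.
move=> qn hq; rewrite hq => nqp; rewrite coprimep_sym /coprimep.
set d := gcdp r q; have [e qe] : exists e, q = e * d by apply/dvdpP; rewrite dvdp_gcdr.
have /orP [re|rd] : root (map_poly val e) x || root (map_poly val d) x.
- by rewrite -rootM -rmorphM /= -qe hq.
- move: re; rewrite hq => qe'; have en : e != 0 by apply: contraNneq qn => e0; rewrite qe e0 mul0r.
  have dn : d != 0 by apply: contraNneq qn => e0; rewrite qe e0 mulr0.
  have := dvdp_leq en qe'; rewrite {1}qe size_mul //.
  case: (size d) (size_poly_eq0 d) (size_poly_eq0 e) => [|[|n]]; rewrite ?(negPf dn) ?(negPf en) //.
  by case: (size e) => // m; rewrite addnS /= !addnS ltnNge leq_addr.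
by move: rd; rewrite hq => qd; case/negP: nqp; apply: dvdp_trans qd (dvdp_gcdl _ _).
Qed.

Lemma minpoly_dvd x p q : is_minpoly A x p -> coefs_in A q -> root q x -> p %| q.
Proof.
move=> /minpoly_lift [f [<- _ h]] /coefs_in_lift [r <-]; rewrite h.
by case/dvdpP => u ->; rewrite rmorphM /= dvdp_mull.
Qed.

End Closure.

Lemma algebraic_elementS A B x : A `<=` B -> algebraic_element A x -> algebraic_element B x.
Proof. by move=> AB [p [cp pn rp]]; exists p; split=> // i; apply/AB/cp. Qed.

Lemma separable_elementS A B x :
  subfield A -> subfield B -> A `<=` B -> separable_element A x -> separable_element B x.
Proof.
move=> hA hB AB [p [mp sp]]; have [m1 cp rp _] := mp.
have [|q mq] := @minpoly_exists B hB x.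
  by exists p; split=> //; [move=> i; apply/AB/cp | apply: monic_neq0].
exists q; split=> //; apply: dvdp_separable sp; apply: minpoly_dvd mq _ rp => //.
by move=> i; apply/AB/cp.
Qed.

(* The graph of an isomorphism over B between two subfields containing B. *)
Definition iso_graph B (G : set (C * C)) :=
  [/\ forall x, B x -> G (x, x),
      forall u w, G u -> G w -> G (u.1 - w.1, u.2 - w.2),
      forall u w, G u -> G w -> G (u.1 / w.1, u.2 / w.2)
    & forall u, G u -> (u.1 == 0) = (u.2 == 0)].

Definition graph_dom (G : set (C * C)) : set C := [set x | exists y, G (x, y)].

Lemma iso_graph_dom B G : subfield B -> iso_graph B G -> subfield (graph_dom G).
Proof.
move=> hB [hd hb hv _]; split.
- by exists 1; apply: hd; exact: (subfield1 hB).
- by move=> x y [x' hx] [y' hy]; exists (x' - y'); apply: (hb (x, x') (y, y')).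
by move=> x y [x' hx] [y' hy]; exists (x' / y'); apply: (hv (x, x') (y, y')).
Qed.

Lemma iso_graph_fun B G x y y' : iso_graph B G -> G (x, y) -> G (x, y') -> y = y'.
Proof.
move=> [_ hb _ h0] h h'; apply/eqP; rewrite -subr_eq0.
by have := h0 _ (hb _ _ h h'); rewrite /= subrr eqxx.
Qed.

Lemma iso_graph_morph B G (hB : subfield B) (hG : iso_graph B G) :
  exists s : {rmorphism subfield_of (iso_graph_dom hB hG) -> C},
    forall x, G (val x, s x).
Proof.
set F := subfield_of _.
have ex (x : F) : exists y, G (val x, y) by apply: (sfvalP x).
have [s hs] := choice ex; have [hd hb hv _] := hG.
have G1 : G (1, 1) by apply: hd; exact: (subfield1 hB).
have G0 : G (0, 0) by apply: hd; exact: (subfield0 hB).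
have sB : zmod_morphism s.
  move=> x y; apply: (iso_graph_fun hG (hs _)).
  by rewrite rmorphB; apply: (hb (val x, s x) (val y, s y)).
have sM : monoid_morphism s.
  split; first by apply: (iso_graph_fun hG (hs _)); rewrite rmorph1.
  move=> x y; apply: (iso_graph_fun hG (hs _)); rewrite rmorphM.
  (* [iso_graph] provides quotients only, so products are written as x / (1 / y). *)
  have -> : \val x * \val y = val x / (1 / val y) by rewrite div1r invrK.
  have -> : s x * s y = s x / (1 / s y) by rewrite div1r invrK.
  apply: (hv (val x, s x) (_, _)) => //.
  by apply: (hv (1, 1) (val y, s y)).
pose m1 := GRing.isZmodMorphism.Build _ _ s sB.
pose m2 := GRing.isMonoidMorphism.Build _ _ s sM.
pose s' : {rmorphism F -> C} := HB.pack s m1 m2.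
by exists s'.
Qed.

(** [H] consists of the pairs (r(x), r'(x')), with r a polynomial over the domain of [G] and r' its
    image. It is closed under quotients because a Bezout relation with the minimal polynomial
    inverts both components by one and the same polynomial. *)
Lemma iso_graph_adjoin B G (x x' : C) (f f' : {poly C}) : subfield B -> iso_graph B G ->
  is_minpoly (graph_dom G) x f -> (forall i, G (f`_i, f'`_i)) -> root f' x' ->
  exists H, [/\ iso_graph B H, G `<=` H & H (x, x')].
Proof.
move=> hB hG mf ff' rf'.
have [s hs] := iso_graph_morph hB hG; move: s hs.
set hD := iso_graph_dom hB hG; set F := subfield_of _ => s hs.
have [q [qf qn hq]] := minpoly_lift hD mf.
have sf : map_poly s q = f'.
  apply/polyP => i; rewrite coef_map; apply: (iso_graph_fun hG (hs _)).
  by rewrite -(coef_map (val : {rmorphism F -> C})) qf.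
pose ev (p : {poly F}) := ((map_poly val p).[x], (map_poly s p).[x']).
have evX : ev 'X = (x, x') by rewrite /ev !map_polyX !hornerX.
have evC a : ev a%:P = (val a, s a) by rewrite /ev !map_polyC !hornerC.
have GH u : G u -> [set ev p | p in setT] u.
  case: u => a b ab; have [|c ca] := @sfval_lift _ hD a; first by exists b.
  exists c%:P => //; rewrite evC ca; congr (_, _).
  by apply: (iso_graph_fun hG (hs c)); rewrite ca.
have q0 : (map_poly val q).[x] = 0 by apply/rootP; rewrite hq.
have q0' : (map_poly s q).[x'] = 0 by rewrite sf; apply/rootP.
have evV p : (map_poly val p).[x] != 0 -> exists r,
    (map_poly val p).[x] * (map_poly val r).[x] = 1
    /\ (map_poly s p).[x'] * (map_poly s r).[x'] = 1.
  move=> /(minpoly_coprime qn hq)/Bezout_eq1_coprimepP [[u w] /= e]; exists w.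
  have := congr1 (fun t : {poly F} => (map_poly val t).[x]) e.
  have := congr1 (fun t : {poly F} => (map_poly s t).[x']) e.
  rewrite !rmorphD !rmorphM !rmorph1 !hornerD !hornerM q0 q0' !mulr0 !add0r !hornerC.
  by move=> e2 e1; split; [rewrite -e1|rewrite -e2]; apply: mulrC.
have ev0 p : ((map_poly val p).[x] == 0) = ((map_poly s p).[x'] == 0).
  apply/idP/idP => [|/eqP h].
    rewrite -/(root _ _) hq => /dvdpP [u ->].
    by rewrite rmorphM hornerM q0' mulr0.
  by apply/negPn/negP => /evV [r [_ /eqP]]; rewrite h mul0r eq_sym oner_eq0.
exists [set ev p | p in setT]; split; last by exists 'X.
  split.
  - by move=> y By; apply: GH; have [h _ _ _] := hG; apply: h.
  - move=> _ _ [p _ <-] [r _ <-]; exists (p - r) => //.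
    by rewrite /ev !rmorphB /= !hornerD !hornerN.
  - move=> _ _ [p _ <-] [r _ <-] /=.
    have [r0|r0] := eqVneq (map_poly val r).[x] 0.
      have /eqP r0' : (map_poly s r).[x'] == 0 by rewrite -ev0 r0.
      by exists 0 => //; rewrite /ev r0 r0' invr0 !mulr0 !rmorph0 !horner0.
    have [t [e1 e2]] := evV _ r0; exists (p * t) => //.
    have r0' : (map_poly s r).[x'] != 0 by rewrite -ev0.
    rewrite /ev !rmorphM !hornerM; congr (_ * _, _ * _).
      by apply: (mulfI r0); rewrite e1 mulfV.
    by apply: (mulfI r0'); rewrite e2 mulfV.
  by move=> _ [p _ <-] /=.
by move=> u /GH.
Qed.
End SubfieldType.

(* For C an algebraic closure of B, the ring endomorphisms of C that fix B are
   bijective, so they are the elements of the absolute Galois group of B. *)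
Definition fixes (C : closedFieldType) (B : set C) (g : C -> C) :=
  forall x, B x -> g x = x.

(** * Automorphisms of an algebraic closure *)

Section Automorphisms.
Variable C : closedFieldType.
Implicit Types (A B : set C) (x y : C) (g h : {rmorphism C -> C}).

Lemma iso_graph_extend B (G : set (C * C)) : is_algebraic_closure B ->
  iso_graph B G -> exists g : {rmorphism C -> C}, forall x y, G (x, y) -> g x = y.
Proof.
move=> [hB algB] hG.
(* The predicate is imposed on the union with [G], so that the empty chain is no exception. *)
have [] := @Zorn_bigcup _ (fun H => iso_graph B (G `|` H)).
  move=> F FP Ftot; have [gd gb gv g0] := hG.
  have two u w : (G `|` \bigcup_(X in F) X) u -> (G `|` \bigcup_(X in F) X) w ->
      exists H, [/\ iso_graph B H, H `<=` G `|` \bigcup_(X in F) X, H u & H w].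
    move=> [Gu|[X FX Xu]] [Gw|[Y FY Yw]].
    - by exists G; split=> // z; left.
    - exists (G `|` Y); split; [exact: FP | | by left | by right].
      by move=> z [|]; [left | right; exists Y].
    - exists (G `|` X); split; [exact: FP | | by right | by left].
      by move=> z [|]; [left | right; exists X].
    - have [XY|YX] := Ftot _ _ FX FY.
        exists (G `|` Y); split; [exact: FP | | by right; apply: XY | by right].
        by move=> z [|]; [left | right; exists Y].
      exists (G `|` X); split; [exact: FP | | by right | by right; apply: YX].
      by move=> z [|]; [left | right; exists X].
  split.
  - by move=> x Bx; left; apply: gd.
  - by move=> u w hu hw; have [H [[_ hb _ _] sH Hu Hw]] := two _ _ hu hw; apply/sH/hb.
  - by move=> u w hu hw; have [H [[_ _ hv _] sH Hu Hw]] := two _ _ hu hw; apply/sH/hv.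
  - by move=> u hu; have [H [[_ _ _ h0] sH Hu Hw]] := two _ _ hu hu; apply: h0.
move=> A [hM maxM]; set M := G `|` A in hM.
have domM x : graph_dom M x.
  apply: contrapT => ndx.
  have hD := iso_graph_dom hB hM.
  have BD : B `<=` graph_dom M by move=> y By; exists y; case: hM => h _ _ _; apply: h.
  have [f mf] := minpoly_exists hD (algebraic_elementS BD (algB x)).
  have [s hs] := iso_graph_morph hB hM.
  have [q [qf qn hq]] := minpoly_lift (iso_graph_dom hB hM) mf.
  have [x' rx'] : exists x', root (map_poly s q) x'.
    apply/closed_rootP; rewrite size_map_poly.
    rewrite -(size_map_poly (val : {rmorphism subfield_of _ -> C})) qf.
    have [m _ rf _] := mf; apply: contraTneq rf => /eqP/size_poly1P [c cn ->].
    by rewrite rootC.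
  have ff' i : M (f`_i, (map_poly s q)`_i) by rewrite -qf !coef_map; apply: hs.
  have [H [hH MH Hx]] := iso_graph_adjoin hB hM mf ff' rx'.
  apply: (maxM H).
    split; last by move=> HA; apply: ndx; exists x'; right; apply: HA.
    by move=> u Au; apply: MH; right.
  suff -> : G `|` H = H by [].
  by apply/seteqP; split=> [u [Gu|//]|u Hu]; [apply: MH; left | right].
have [s hs] := iso_graph_morph hB hM.
have [t tK] := choice (fun x => sfval_lift (iso_graph_dom hB hM) (domM x)).
have tB : zmod_morphism t.
  by move=> x y; apply: val_inj; rewrite tK rmorphB; congr (_ - _); apply/esym/tK.
have tM : monoid_morphism t.
  split=> [|x y]; apply: val_inj; first by rewrite tK rmorph1.
  by rewrite tK rmorphM; congr (_ * _); apply/esym/tK.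
pose m1 := GRing.isZmodMorphism.Build _ _ t tB.
pose m2 := GRing.isMonoidMorphism.Build _ _ t tM.
pose t' : {rmorphism C -> _} := HB.pack t m1 m2.
exists (s \o t') => x y Gxy /=; apply: (iso_graph_fun hM (hs _)).
by rewrite tK; left.
Qed.

Lemma field_hom_extend B D (s : C -> C) :
  is_algebraic_closure B -> subfield D -> B `<=` D -> field_hom_on D s ->
  fixes B s -> exists2 g : {rmorphism C -> C}, fixes B g & forall x, D x -> g x = s x.
Proof.
move=> aB hD BD [s1 sD sM] fs; have [hB _] := aB.
have s0 : s 0 = 0.
  by apply: (@addrI _ (s 0)); rewrite -sD ?addr0 //; apply: (subfield0 hD).
have sB x y : D x -> D y -> s (x - y) = s x - s y.
  move=> Dx Dy; apply/eqP; rewrite eq_sym subr_eq -sD ?subrK //.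
  exact: (subfieldB hD).
have sn0 x : D x -> x != 0 -> s x != 0.
  move=> Dx x0; apply/eqP => sx; move/eqP: (oner_neq0 C); apply.
  by rewrite -s1 -(mulfV x0) sM ?sx ?mul0r //; apply: (subfieldV hD).
have sV x : D x -> s x^-1 = (s x)^-1.
  move=> Dx; have [->|x0] := eqVneq x 0; first by rewrite invr0 s0 invr0.
  apply: (mulfI (sn0 _ Dx x0)); rewrite -sM ?mulfV // ?s1 ?sn0 //.
  exact: (subfieldV hD).
have [|g hg] := @iso_graph_extend B [set u | D u.1 /\ u.2 = s u.1] aB.
  split.
  - by move=> x Bx /=; split; [apply: BD | rewrite fs].
  - move=> [x _] [y _] /= [Dx ->] [Dy ->]; rewrite sB //; split=> //.
    exact: (subfieldB hD).
  - move=> [x _] [y _] /= [Dx ->] [Dy ->]; rewrite sM ?sV //.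
      by split=> //; apply: (subfield_div hD).
    exact: (subfieldV hD).
  - move=> [x _] /= [Dx ->]; have [->|x0] := eqVneq x 0; first by rewrite s0 eqxx.
    by rewrite (negPf (sn0 _ Dx x0)).
exists g => x hx; last by apply: hg.
by rewrite -[RHS](fs x hx); apply: hg; split=> //=; apply: BD.
Qed.

Section Closure.
Variables (B : set C) (aB : is_algebraic_closure B).
Let hB : subfield B := aB.1.

Lemma algebraic_closureS A : subfield A -> B `<=` A -> is_algebraic_closure A.
Proof. by move=> hA BA; split=> // x; apply: algebraic_elementS BA (aB.2 x). Qed.

Lemma fixesS A g : B `<=` A -> fixes A g -> fixes B g.
Proof. by move=> BA h x /BA /h. Qed.

Lemma fixes_comp g h : fixes B g -> fixes B h -> fixes B (g \o h).
Proof. by move=> fg fh x Bx /=; rewrite fh ?fg. Qed.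

Lemma fixes_map_poly g p : fixes B g -> coefs_in B p -> map_poly g p = p.
Proof. by move=> fg cp; apply/polyP => i; rewrite coef_map /= fg. Qed.

Lemma fixes_root g p x : fixes B g -> coefs_in B p -> root p x -> root p (g x).
Proof.
by move=> fg cp /rootP rp; rewrite -(fixes_map_poly fg cp) /root horner_map rp rmorph0.
Qed.

Lemma conjugates x : exists s : seq C, exists p, [/\ is_minpoly B x p, uniq s,
  forall y, (y \in s) = root p y & forall g, fixes B g -> {in s, forall y, g y \in s}].
Proof.
have [p mp] := minpoly_exists hB (aB.2 x); have [m cp rp _] := mp.
have [r pr] := closed_field_poly_normal p; exists (undup r), p.
have hr y : (y \in undup r) = root p y.
  rewrite mem_undup pr rootZ ?lead_coef_eq0 ?monic_neq0 //.
  by rewrite root_prod_XsubC.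
split=> //; first exact: undup_uniq.
by move=> g fg y; rewrite !hr; apply: fixes_root.
Qed.

(** An endomorphism over [B] maps the finite set of conjugates of any y injectively into itself,
    hence onto it. *)
Lemma fixes_inv g : fixes B g ->
  exists h : {rmorphism C -> C}, [/\ fixes B h, cancel g h & cancel h g].
Proof.
move=> fg; have gi : injective g by apply: fmorph_inj.
have gs y : exists x, g x = y.
  have [s [p [mp us hs st]]] := conjugates y; have ys : y \in s by rewrite hs; case: mp.
  have gss : {subset map g s <= s} by move=> z /mapP [w ws ->]; apply: st.
  have ug : uniq (map g s) by rewrite map_inj_uniq.
  have [|_ e] := uniq_min_size ug gss; first by rewrite size_map.
  by move: ys; rewrite -e => /mapP [x _ ->]; exists x.
have [h hK] := choice gs; have Kh : cancel g h by move=> x; apply: gi; rewrite hK.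
have hBm : zmod_morphism h by move=> x y; apply: gi; rewrite rmorphB !hK.
have hM : monoid_morphism h.
  by split=> [|x y]; apply: gi; rewrite ?rmorphM ?hK ?rmorph1.
pose m1 := GRing.isZmodMorphism.Build _ _ h hBm.
pose m2 := GRing.isMonoidMorphism.Build _ _ h hM.
pose h' : {rmorphism C -> C} := HB.pack h m1 m2.
by exists h'; split=> // x Bx; apply: gi; rewrite hK fg.
Qed.

Lemma fixes_conj x y p : is_minpoly B x p -> root p y ->
  exists2 g : {rmorphism C -> C}, fixes B g & g x = y.
Proof.
move=> mp ry; have hG : iso_graph B [set u : C * C | B u.1 /\ u.2 = u.1].
  split=> [z Bz //|[a _] [b _] /= [Ba ->] [Bb ->]|[a _] [b _] /= [Ba ->] [Bb ->]|
    [a _] /= [Ba ->] //].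
    by split=> //; apply: (subfieldB hB).
  by split=> //; apply: (subfield_div hB).
have dE : graph_dom [set u : C * C | B u.1 /\ u.2 = u.1] = B.
  by apply/seteqP; split=> [z [w []] //|z Bz]; exists z.
have mp' : is_minpoly (graph_dom [set u : C * C | B u.1 /\ u.2 = u.1]) x p by rewrite dE.
have [|H [hH GH Hxy]] := iso_graph_adjoin hB hG mp' _ ry.
  by move=> i; case: mp => _ cp _ _; split=> //; apply: cp.
have [g hg] := iso_graph_extend aB hH; exists g; last exact: hg.
by move=> z Bz; apply/hg/GH.
Qed.

End Closure.

Lemma normal_conj B D g : is_algebraic_closure B -> normal_extension B D ->
  fixes B g -> forall x, D x -> D (g x).
Proof.
move=> aB nD fg x Dx; have [p mp] := minpoly_exists aB.1 (aB.2 x).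
by apply: (nD _ _ Dx mp); case: (mp) => _ cp rp _; apply: fixes_root cp rp.
Qed.

Lemma fixed_minpoly A x p : is_algebraic_closure A -> is_minpoly A x p ->
  (forall g, fixes A g -> g x = x) -> p = ('X - x%:P) ^+ (size p).-1.
Proof.
move=> aA mp fx; have [r pr] := closed_field_poly_normal p; have [m cp rp _] := mp.
have rx : {in r, forall y, y = x}.
  move=> y yr; have [|g fg <-] := fixes_conj aA mp (y := y); last exact: fx.
  by rewrite pr rootZ ?lead_coef_eq0 ?monic_neq0 // root_prod_XsubC.
have e : p = ('X - x%:P) ^+ size r.
  rewrite pr (monicP m) scale1r (eq_big_seq (fun=> 'X - x%:P)); last by move=> y /rx ->.
  by rewrite big_const_seq count_predT iter_mulr_1.
by rewrite {1}e e size_exp_XsubC.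
Qed.

End Automorphisms.

Section FixedElements.
Variable C : closedFieldType.
Implicit Types (A B : set C) (x y : C) (g h : {rmorphism C -> C}).

(** The minimal polynomial is (X - x)^N. With N = n k, where n is the part of N at the
    characteristic and k is invertible in [C], it equals (X^n - x^n)^k, whose coefficient in degree
    n (k - 1) is - k x^n. In characteristic 0 this has n = 1. *)
Lemma fixed_purely_inseparable A x : is_algebraic_closure A ->
  (forall g, fixes A g -> g x = x) -> exists2 n, [pchar C].-nat n & A (x ^+ n).
Proof.
move=> aA fx; have [p mp] := minpoly_exists aA.1 (aA.2 x); have [m cp rp _] := mp.
have := fixed_minpoly aA mp fx; set N := (size p).-1 => pE.
have N0 : (0 < N)%N.
  rewrite lt0n; apply: contraTneq rp => N0.
  by rewrite pE N0 expr0 rootE hornerC oner_eq0.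
set n := (N`_[pchar C])%N; have nn : [pchar C].-nat n by apply: part_pnat.
pose k := (N`_([pchar C]^'))%N; have kn : k%:R != 0 :> C.
  by rewrite natf_neq0_pchar; apply: part_pnat.
have nk : (n * k)%N = N by apply: partnC.
exists n => //; set c := x ^+ n.
have pE' : p = \prod_(z <- nseq k c) ('X - z%:P) \Po 'X^n.
  rewrite big_nseq iter_mulr_1 rmorphXn /= comp_polyB comp_polyX comp_polyC.
  rewrite pE -nk exprM exprB_pchar; last by rewrite (eq_pnat _ (pchar_poly C)).
  by rewrite polyC_exp.
have k0 : (0 < k)%N by apply: part_gt0.
have n0 : (0 < n)%N by apply: part_gt0.
have := cp (n * k.-1)%N; rewrite pE' coef_comp_poly_Xn // dvdn_mulr // mulKn //.
have e := @coefPn_prod_XsubC _ (nseq k c); rewrite size_nseq -lt0n in e.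
rewrite e // big_nseq iter_addr_0 => h.
suff -> : c = - (- (c *+ k)) / k%:R.
  by apply: (subfield_div aA.1); [apply: (subfieldN aA.1) | apply: (subfield_nat aA.1)].
by rewrite opprK -mulr_natr mulfK.
Qed.

(** The minimal polynomial of a fixed element is a power of X - x; it divides [f], and a simple root
    of [f] leaves only the exponent 1. *)
Lemma fixed_simple_root A x f : is_algebraic_closure A ->
  (forall g, fixes A g -> g x = x) ->
  coefs_in A f -> root f x -> f^`().[x] != 0 -> A x.
Proof.
move=> aA fx cf rf df; have [p mp] := minpoly_exists aA.1 (aA.2 x).
have [m cp rp _] := mp; have := fixed_minpoly aA mp fx; set N := (size p).-1 => pE.
have /dvdpP [u fE] := minpoly_dvd aA.1 mp cf rf.
have N0 : (0 < N)%N.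
  rewrite lt0n; apply: contraTneq rp => N0.
  by rewrite pE N0 expr0 rootE hornerC oner_eq0.
have N1 : N = 1%N.
  apply/eqP; rewrite eqn_leq N0 andbT leqNgt; apply: contra df => N2.
  have : ('X - x%:P).[x] = 0 by rewrite hornerXsubC subrr.
  rewrite fE pE -(subnK N2) exprD expr2; move: ('X - _) => l lx.
  by rewrite !derivM !(hornerM, hornerD) lx !(mulr0, mul0r, addr0).
have e : p = 'X - x%:P by rewrite pE N1 expr1.
have := cp 0%N; rewrite e coefB coefX coefC sub0r => /(subfieldN aA.1).
by rewrite opprK.
Qed.

End FixedElements.

(** * Finite extensions *)

Section FiniteExtensions.
Variable C : fieldType.
Implicit Types (A B D : set C) (x y : C).

(** Any finite index type is allowed, so that a basis of a tower can be indexed by pairs. *)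
Definition is_basis A B (I : finType) (b : I -> C) :=
  [/\ forall i, B (b i),
      forall x, B x -> exists2 c : I -> C, (forall i, A (c i)) & x = \sum_i c i * b i
    & forall c : I -> C, (forall i, A (c i)) -> \sum_i c i * b i = 0 -> forall i, c i = 0].

Lemma degree_basis A B (I : finType) (b : I -> C) : subfield A ->
  is_basis A B b -> degree A B #|I|.
Proof.
move=> hA [Bb gen ind]; exists (fun k => b (enum_val k)) => // x Bx.
have reind (c : I -> C) : \sum_i c i * b i = \sum_(k < #|I|) c (enum_val k) * b (enum_val k).
  by rewrite (reindex _ (onW_bij _ (enum_val_bij I))).
have [c Ac ->] := gen x Bx.
exists [ffun k => c (enum_val k)]; split=> [|d [Ad e]].
  split=> [i|]; first by rewrite ffunE.
  by rewrite reind; apply: eq_bigr => i _; rewrite ffunE.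
apply/ffunP => k; rewrite ffunE; apply/eqP; rewrite -subr_eq0; apply/eqP.
have h := ind (fun i => c i - d (enum_rank i)).
have := h _ _ (enum_val k); rewrite enum_valK; apply.
  by move=> i; apply: (subfieldB hA).
rewrite reind; under eq_bigr do rewrite enum_valK mulrBl.
by rewrite sumrB -reind e subrr.
Qed.

Lemma basis_degree A B n : subfield A -> B 0 -> degree A B n ->
  exists b : 'I_n -> C, is_basis A B b.
Proof.
move=> hA B0 [b Bb gen]; exists b; split=> // [x Bx|c Ac c0].
  by have [c [[Ac e] _]] := gen x Bx; exists c.
have [d [_ un]] := gen 0 B0 => i.
have := un [ffun i => c i]; have := un [ffun i => 0] => e0 e1.
have {e0} : d = [ffun i => 0].
  apply: e0; split=> [j|]; first by rewrite ffunE; apply: (subfield0 hA).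
  by rewrite big1 // => j _; rewrite ffunE mul0r.
have {e1} -> : d = [ffun i => c i].
  apply: e1; split=> [j|]; first by rewrite ffunE.
  by rewrite -[LHS]c0; apply: eq_bigr => j _; rewrite ffunE.
by move/ffunP/(_ i); rewrite !ffunE.
Qed.

Lemma basis_trans A B D (I J : finType) (b : I -> C) (d : J -> C) :
  subfield B -> subfield D -> A `<=` B -> B `<=` D -> is_basis A B b -> is_basis B D d ->
  is_basis A D (fun ij : I * J => b ij.1 * d ij.2).
Proof.
move=> hB hD AB BD [Bb gb ib] [Dd gd id].
have dbl (c : I * J -> C) :
    \sum_ij c ij * (b ij.1 * d ij.2) = \sum_j (\sum_i c (i, j) * b i) * d j.
  rewrite (eq_bigr (fun ij => c (ij.1, ij.2) * (b ij.1 * d ij.2))); last by case.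
  rewrite -(pair_bigA _ (fun i j => c (i, j) * (b i * d j))) /= exchange_big.
  by apply: eq_bigr => j _; rewrite mulr_suml; apply: eq_bigr => i _; rewrite mulrA.
split=> [[i j] /=|x Dx|c Ac].
- by apply: (subfieldM hD) => //; apply: BD.
- have [e Be ->] := gd x Dx.
  have /choice [c hc] : forall j, exists c : I -> C, (forall i, A (c i)) /\ e j = \sum_i c i * b i.
    by move=> j; have [c Ac ce] := gb _ (Be j); exists c.
  exists (fun ij => c ij.2 ij.1) => [[i j]|]; first by case: (hc j).
  by rewrite dbl; apply: eq_bigr => j _; case: (hc j) => _ ->.
rewrite dbl => /id h [i j]; apply: (ib (fun i => c (i, j))) => //.
apply: (h _ j) => k; apply: (subfield_sum hB) => l _.
by apply: (subfieldM hB) => //; apply/AB/Ac.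
Qed.

(** The field is A[x], with the powers of [x] below the degree of the minimal polynomial as a
    basis. *)
Lemma simple_extension A x : subfield A -> algebraic_element A x ->
  exists M, [/\ subfield M, A `<=` M, M x, finite_extension A M
    & forall D, subfield D -> A `<=` D -> D x -> M `<=` D].
Proof.
move=> hA ax; have [p mp] := minpoly_exists hA ax.
have [q [qp qn hq]] := minpoly_lift hA mp; set F := subfield_of hA in q qp qn hq.
pose ev (r : {poly F}) := (map_poly val r).[x].
pose M := [set ev r | r in setT].
have evV r : ev r != 0 -> exists2 t, ev r * ev t = 1 & True.
  move=> /(minpoly_coprime qn hq)/Bezout_eq1_coprimepP [[u w] /= e]; exists w => //.
  have := congr1 ev e; rewrite /ev rmorphD !rmorphM rmorph1 hornerD !hornerM hornerC.
  have -> : (map_poly val q).[x] = 0 by apply/rootP; rewrite hq.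
  by rewrite mulr0 add0r mulrC.
have hM : subfield M.
  split; first by exists 1 => //; rewrite /ev rmorph1 hornerC.
    by move=> _ _ [r _ <-] [t _ <-]; exists (r - t) => //; rewrite /ev rmorphB hornerD hornerN.
  move=> _ _ [r _ <-] [t _ <-]; have [t0|t0] := eqVneq (ev t) 0.
    by exists 0 => //; rewrite t0 invr0 mulr0 /ev rmorph0 horner0.
  have [w hw _] := evV t t0; exists (r * w) => //; rewrite /ev rmorphM hornerM -/(ev _) -/(ev _).
  by congr (_ * _); apply: (mulfI t0); rewrite hw mulfV.
have AM : A `<=` M.
  move=> a /(sfval_lift hA) [c <-]; exists c%:P => //.
  by rewrite /ev map_polyC hornerC.
have Mx : M x by exists 'X => //; rewrite /ev map_polyX hornerX.
exists M; split=> //; last first.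
  move=> D hD AD Dx _ [r _ <-]; apply: coefs_in_horner => // i.
  by apply: AD; apply: coefs_in_map.
exists #|'I_(size q).-1|; apply: (degree_basis (b := fun i : 'I_(size q).-1 => x ^+ i)) => //.
have sq r : (size (r %% q)%R <= (size q).-1)%N.
  by rewrite -ltnS prednK ?ltn_modp // lt0n size_poly_eq0.
split=> [i|_ [r _ <-]|c Ac].
- exact: (subfieldX hM _ Mx).
- exists (fun i : 'I_(size q).-1 => val (r %% q)`_i) => [i|]; first exact: sfvalP.
  have -> : ev r = ev (r %% q).
    rewrite {1}(divp_eq r q) /ev rmorphD rmorphM hornerD hornerM.
    have -> : (map_poly val q).[x] = 0 by apply/rootP; rewrite hq.
    by rewrite mulr0 add0r.
  rewrite /ev (horner_coef_wide x (n := (size q).-1)) ?size_map_poly //.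
  by apply: eq_bigr => i _; rewrite coef_map.
have [d hd] := choice (fun i => sfval_lift hA (Ac i)) => e i.
pose r := \poly_(j < (size q).-1) (if insub j is Some k then d k else 0).
have dr (j : 'I_(size q).-1) : r`_j = d j by rewrite coef_poly ltn_ord valK.
suff r0 : r = 0 by rewrite -hd -dr r0 coef0 rmorph0.
apply/eqP; rewrite -(@modp_small _ r q); last first.
  by rewrite (leq_ltn_trans (size_poly _ _)) // prednK // lt0n size_poly_eq0.
rewrite -/(q %| r) -hq; apply/rootP; rewrite -[RHS]e.
rewrite (horner_coef_wide x (n := (size q).-1)) ?size_map_poly ?size_poly //.
by apply: eq_bigr => j _; rewrite coef_map dr; congr (_ * _); apply: hd.
Qed.

Lemma finite_generation A (s : seq C) : subfield A ->
  (forall x, algebraic_element A x) ->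
  exists M, [/\ subfield M, A `<=` M, {in s, forall x, M x}, finite_extension A M
    & forall D, subfield D -> A `<=` D -> {in s, forall x, D x} -> M `<=` D].
Proof.
elim: s A => [|x s IH] A hA aA.
  exists A; split=> //; exists #|'I_1|; apply: (degree_basis (b := fun=> 1)) => //.
  split=> [i|x Ax|c Ac e i]; first exact: (subfield1 hA).
    by exists (fun=> x) => //; rewrite big_ord1 mulr1.
  by move: e; rewrite big_ord1 mulr1 [i]ord1.
have [M [hM AM Mx fM sM]] := simple_extension hA (aA x).
have [|N [hN MN Ns fN sN]] := IH M hM.
  by move=> y; apply: algebraic_elementS AM (aA y).
exists N; split=> //.
- exact: subset_trans AM MN.
- by move=> y; rewrite in_cons => /orP [/eqP -> |/Ns //]; apply: MN.
- have [[n dn] [m dm]] := (fM, fN).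
  have [b hb] := basis_degree hA (subfield0 hM) dn.
  have [d hd] := basis_degree hM (subfield0 hN) dm.
  by exists #|{: 'I_n * 'I_m}|; apply: degree_basis hA (basis_trans hM hN AM MN hb hd).
move=> D hD AD Ds; apply: sN => //.
  by apply: sM => //; apply: Ds; rewrite mem_head.
by move=> y ys; apply: Ds; rewrite in_cons ys orbT.
Qed.

End FiniteExtensions.

(** * Valuations and leading terms *)

Section SmallElements.
Variables (C : fieldType) (v : valuation C).
Implicit Types (x y z : C) (k l m : vgroup v).

(* v x > k, where v 0 is infinite *)
Definition small k x := (x == 0) || (k < v x).

(* For x <> 0: the ratio g x / x has residue 1. *)
Definition graded (g : C -> C) x := small (v x) (g x - x).

Lemma vg_ltNge k l : (k < l) = ~~ (l <= k).
Proof.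
have [lk|kl] := boolP (l <= k); first by apply/negbTE/negP => /lt_le_trans/(_ lk); rewrite ltxx.
have := vgroup_total k l; rewrite (negPf kl) orbF le_eqVlt => /orP [/eqP e|//].
by rewrite e lexx in kl.
Qed.

Lemma vg_leNgt k l : (k <= l) = ~~ (l < k).
Proof. by rewrite vg_ltNge negbK. Qed.

Lemma vg_leD2 k l m : (m + k <= m + l) = (k <= l).
Proof.
apply/idP/idP => [|h]; last exact: vgroup_leD2l.
by move/(vgroup_leD2l (- m)); rewrite !addKr.
Qed.

Lemma vg_ltD2 k l m : (m + k < m + l) = (k < l).
Proof. by rewrite !vg_ltNge vg_leD2. Qed.

Lemma vg_mulrn_lt0 k n : k < 0 -> k *+ n.+1 < 0.
Proof.
move=> k0; elim: n => [//|n IH]; rewrite mulrS.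
by apply: lt_trans k0; rewrite -[X in _ < X]addr0 vg_ltD2.
Qed.

Lemma valX x n : x != 0 -> v (x ^+ n) = v x *+ n.
Proof.
move=> x0; elim: n => [|n IH]; first by rewrite expr0 val1.
by rewrite exprS mulrS valM ?expf_neq0 // IH.
Qed.

Lemma val_div x y : x != 0 -> y != 0 -> v (x / y) = v x - v y.
Proof. by move=> x0 y0; rewrite valM ?invr_eq0 // valV. Qed.

Lemma val_prod (I : Type) (r : seq I) (f : I -> C) : (forall i, f i != 0) ->
  v (\prod_(i <- r) f i) = \sum_(i <- r) v (f i).
Proof.
move=> f0; suff [//] : \prod_(i <- r) f i != 0 /\ v (\prod_(i <- r) f i) = \sum_(i <- r) v (f i).
elim: r => [|i r [h1 h2]]; first by rewrite !big_nil oner_neq0 val1.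
by rewrite !big_cons mulf_neq0 // valM // h2.
Qed.

Lemma vringE x : (x \in vring v) = (x == 0) || (0 <= v x). Proof. by []. Qed.

Lemma vringN0 x : x != 0 -> (x \in vring v) = (0 <= v x).
Proof. by rewrite vringE => /negPf ->. Qed.

Lemma small0 k : small k 0. Proof. by rewrite /small eqxx. Qed.

Lemma smallN0 k x : x != 0 -> small k x = (k < v x).
Proof. by rewrite /small => /negPf ->. Qed.

Lemma smallN k x : small k (- x) = small k x.
Proof.
have [->|x0] := eqVneq x 0; first by rewrite oppr0.
by rewrite !smallN0 ?oppr_eq0 // valN.
Qed.

Lemma smallD k x y : small k x -> small k y -> small k (x + y).
Proof.
have [->|x0] := eqVneq x 0; first by rewrite add0r.
have [->|y0] := eqVneq y 0; first by rewrite addr0.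
have [->|s0] := eqVneq (x + y) 0; first by rewrite small0.
rewrite !smallN0 // => hx hy.
by case/orP: (valD v x0 y0 s0); apply: lt_le_trans.
Qed.

Lemma smallB k x y : small k x -> small k y -> small k (x - y).
Proof. by move=> hx hy; apply: smallD; rewrite ?smallN. Qed.

Lemma small_sum k (I : Type) (r : seq I) (P : pred I) (f : I -> C) :
  (forall i, P i -> small k (f i)) -> small k (\sum_(i <- r | P i) f i).
Proof. by move=> h; elim/big_ind: _ => //; [apply: small0 | apply: smallD]. Qed.

Lemma small_lt k l x : k <= l -> small l x -> small k x.
Proof.
move=> kl; have [->|x0] := eqVneq x 0; first by rewrite !small0.
by rewrite !smallN0 //; apply: le_lt_trans.
Qed.

Lemma smallM k x y : x != 0 -> small (v x + k) (x * y) = small k y.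
Proof.
move=> x0; have [->|y0] := eqVneq y 0; first by rewrite mulr0 !small0.
by rewrite !smallN0 ?mulf_neq0 // valM // vg_ltD2.
Qed.

Lemma smallMl k x y : x \in vring v -> small k y -> small k (x * y).
Proof.
have [->|x0] := eqVneq x 0; first by rewrite mul0r small0.
rewrite vringN0 // => vx hy; apply: (@small_lt _ (v x + k)); last by rewrite smallM.
by rewrite -[X in X <= _]add0r ![_ + k]addrC vgroup_leD2l.
Qed.

Lemma small_vring x : small 0 x -> x \in vring v.
Proof.
have [->|x0] := eqVneq x 0; first by rewrite rpred0.
by rewrite smallN0 // vringN0 //; apply: ltW.
Qed.

Lemma small_self x : small (v x) x -> x = 0.
Proof. by rewrite /small ltxx orbF => /eqP. Qed.

Lemma small_val x y : y != 0 -> small (v y) (x - y) -> x != 0 /\ v x = v y.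
Proof.
move=> y0 h; have xn : x != 0.
  by apply: contraNneq y0 => e; move: h; rewrite e sub0r smallN => /small_self ->.
split=> //; have [e|d0] := eqVneq (x - y) 0; first by move/eqP: e; rewrite subr_eq0 => /eqP ->.
apply/le_anti; rewrite !vg_leNgt; apply/andP; split; apply/negP => lt.
  have := @smallB (v y) x (x - y); rewrite smallN0 // lt => /(_ isT h).
  by rewrite subKr => /small_self e; rewrite e eqxx in y0.
have := @smallB (v x) y (y - x); rewrite smallN0 // lt subKr => /(_ isT).
rewrite -opprB smallN => h'; have /h' : small (v x) (x - y) by apply: small_lt h; apply: ltW.
by move/small_self => e; rewrite e eqxx in xn.
Qed.

Lemma unit_val x : x != 0 -> (x \in vring v) -> ~~ small 0 x -> v x = 0.
Proof.
move=> x0; rewrite vringN0 // smallN0 // -vg_leNgt => h1 h2.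
by apply/le_anti; rewrite h1 h2.
Qed.

Lemma vring_val0 x : x != 0 -> v x = 0 -> x \in vring v.
Proof. by move=> x0 e; rewrite vringN0 // e lexx. Qed.

Lemma vring_exp x n : (0 < n)%N -> x ^+ n \in vring v -> x \in vring v.
Proof.
case: n => // n _; have [->|x0] := eqVneq x 0; first by rewrite rpred0.
rewrite !vringN0 ?expf_neq0 // valX // => h; rewrite vg_leNgt.
by apply/negP => /(vg_mulrn_lt0 n); rewrite vg_ltNge h.
Qed.

Lemma vring_lift x : x \in vring v -> exists a : vring_of v, val a = x.
Proof. by move=> h; exists (VringOf h). Qed.

Lemma res_small (a : vring_of v) : (res v a == 0) = small 0 (val a).
Proof. exact: res_eq0. Qed.

Lemma resB (a b : vring_of v) : res v (a - b) = res v a - res v b.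
Proof. exact: rmorphB. Qed.

Lemma resX (a : vring_of v) n : res v (a ^+ n) = res v a ^+ n.
Proof. exact: rmorphXn. Qed.

Lemma res_nat n : res v n%:R = n%:R.
Proof. exact: rmorph_nat. Qed.

Lemma res_eq (a b : vring_of v) : (res v a == res v b) = small 0 (val a - val b).
Proof. by rewrite -subr_eq0 -resB res_small. Qed.

Section ResidueChar.
Variables (p : nat) (hp : p \in [pchar (residue v)]).

Lemma res_char_prime : prime p. Proof. by case/andP: hp. Qed.

Lemma small_nat n : small 0 (n%:R : C) = (p %| n)%N.
Proof.
have -> : n%:R = val (n%:R : vring_of v) by rewrite rmorph_nat.
by rewrite -res_small res_nat -(dvdn_pcharf hp).
Qed.

Lemma pchar_res_char n : [pchar C].-nat n -> exists j, n = (p ^ j)%N.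
Proof.
move=> hn; suff /p_natP [j ->] : p.-nat n by exists j.
apply: sub_in_pnat hn => q _ qC; rewrite inE.
have : small 0 (q%:R : C) by case/andP: qC => _ /eqP ->; rewrite small0.
rewrite small_nat => pq; case/andP: qC => qp _.
by move: pq; rewrite dvdn_prime2 ?res_char_prime // eq_sym.
Qed.

Lemma pchar_residue n : [pchar (residue v)].-nat n -> exists j, n = (p ^ j)%N.
Proof.
move=> hn; suff /p_natP [j ->] : p.-nat n by exists j.
by rewrite -(eq_pnat _ (pcharf_eq hp)).
Qed.

Lemma pchar_nat_exp (k : nat) : [pchar (residue v)].-nat (p ^ k)%N.
Proof. by rewrite (eq_pnat _ (pcharf_eq hp)) pnatX pnat_id // res_char_prime. Qed.

(** Frobenius is injective on the residue field. [C] may have characteristic 0, so p-powers are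
    additive only after reduction; that [x] is integral follows from its power being so. *)
Lemma small_pexp x y (k : nat) : y \in vring v ->
  small 0 (x ^+ (p ^ k) - y ^+ (p ^ k)) -> small 0 (x - y).
Proof.
move=> vy h; have : x ^+ (p ^ k) \in vring v.
  by rewrite -[x ^+ _](subrK (y ^+ (p ^ k))) rpredD ?rpredX // small_vring.
move/vring_exp; rewrite expn_gt0 prime_gt0 ?res_char_prime // => /(_ isT) vx.
have [[a ea] [b eb]] := (vring_lift vx, vring_lift vy).
have := h; rewrite -ea -eb -!rmorphXn => h'.
have : res v (a ^+ (p ^ k)) == res v (b ^+ (p ^ k)) by rewrite res_eq.
rewrite -subr_eq0 !resX -exprB_pchar ?pchar_nat_exp // expf_eq0 => /andP [_].
by rewrite subr_eq0 res_eq.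
Qed.

End ResidueChar.
End SmallElements.
Arguments small {C} v k x.

(** * Action of automorphisms on leading terms *)

Section ValuedAutomorphisms.
Variables (C : closedFieldType) (v : valuation C).
Implicit Types (A B K L : set C) (x y z : C) (k : vgroup v) (g h : {rmorphism C -> C}).

Definition isometric (g : C -> C) := forall x, x != 0 -> v (g x) = v x.

Lemma small_isometric g k x : isometric g -> small v k (g x) = small v k x.
Proof.
by move=> vg; rewrite /small fmorph_eq0; have [//|x0] := eqVneq x 0; rewrite vg.
Qed.

Lemma vring_isometric g x : isometric g -> (g x \in vring v) = (x \in vring v).
Proof.
by move=> vg; rewrite !vringE fmorph_eq0; have [//|x0] := eqVneq x 0; rewrite vg.
Qed.

Lemma graded0 g : graded v g 0.
Proof. by rewrite /graded rmorph0 subrr small0. Qed.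

Lemma graded_fixed g x : g x = x -> graded v g x.
Proof. by rewrite /graded => ->; rewrite subrr small0. Qed.

Lemma graded_ratio g x : x != 0 -> graded v g x = small v 0 (g x / x - 1).
Proof.
move=> x0; rewrite -(smallM 0 _ x0) addr0 /graded; congr small.
by rewrite mulrBr mulr1 mulrC divfK.
Qed.

Lemma graded_exp p g x (k : nat) : p \in [pchar (residue v)] ->
  graded v g (x ^+ (p ^ k)) -> graded v g x.
Proof.
have [->|x0] := eqVneq x 0; first by rewrite graded0.
move=> hp; rewrite !graded_ratio ?expf_neq0 // rmorphXn -expr_div_n => h.
by apply: (small_pexp (k := k) hp); rewrite ?rpred1 ?expr1n.
Qed.

Lemma graded_comp g h x : isometric g -> graded v g x -> graded v h x ->
  graded v (g \o h) x.
Proof.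
move=> vg hg hh; rewrite /graded /=.
have -> : g (h x) - x = g (h x - x) + (g x - x) by rewrite rmorphB addrA subrK.
by apply: smallD => //; rewrite small_isometric.
Qed.

(** Composing v with an automorphism h over [K] gives an extension of v|K, so h preserves the
    valuation ring and the order of values. If v x < v (h x), the values along the orbit of x would
    increase strictly, but x has finitely many conjugates. *)
Lemma henselian_isometric K g : henselian v K -> fixes K g -> isometric g.
Proof.
move=> [aK uK].
have key h : fixes K h -> exists w : valuation C,
    (forall x, K x -> (x \in vring w) = (x \in vring v)) /\
    forall x, (x \in vring w) = (h x \in vring v).
  move=> fh; have wM x y : x != 0 -> y != 0 -> v (h (x * y)) = v (h x) + v (h y).
    by move=> x0 y0; rewrite rmorphM valM ?fmorph_eq0.
  have wD x y : x != 0 -> y != 0 -> x + y != 0 ->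
      (v (h x) <= v (h (x + y))) || (v (h y) <= v (h (x + y))).
    by move=> x0 y0 s0; rewrite rmorphD; apply: valD; rewrite -?rmorphD ?fmorph_eq0.
  pose w := Valuation (@vgroup_total _ v) (@vgroup_leD2l _ v) wM wD.
  have e x : (x \in vring w) = (h x \in vring v).
    by rewrite !unfold_in /vring fmorph_eq0.
  by exists w; split=> // x Kx; rewrite e fh.
have pres h x : fixes K h -> (h x \in vring v) = (x \in vring v).
  by move=> /key [w [wK e]]; rewrite -e uK.
have lt_pres h x y : fixes K h -> x != 0 -> y != 0 -> (v (h x) < v (h y)) = (v x < v y).
  have e z z' : z != 0 -> z' != 0 -> (v z < v z') = (z / z' \notin vring v).
    move=> z0 z0'; rewrite vringN0 ?mulf_neq0 ?invr_eq0 // val_div // vg_ltNge; congr negb.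
    by rewrite -(vg_leD2 _ _ (- v z')) addNr addrC.
  by move=> fh x0 y0; rewrite !e ?fmorph_eq0 // -fmorph_div pres.
have main h x : fixes K h -> x != 0 -> ~~ (v x < v (h x)).
  move=> fh x0; apply/negP => lt.
  have it0 i : iter i h x != 0 by elim: i => //= i; rewrite fmorph_eq0.
  have lt1 i : v (iter i h x) < v (iter i.+1 h x).
    by elim: i => [//|i IH]; rewrite !iterS lt_pres // ?fmorph_eq0 //=.
  have lti i j : v (iter i h x) < v (iter (i + j.+1) h x).
    elim: j => [|j IH]; first by rewrite addn1.
    by rewrite addnS; apply: lt_trans IH (lt1 _).
  have [s [q [mq us hs st]]] := conjugates aK x.
  have xs : x \in s by rewrite hs; case: mq.
  have its i : iter i h x \in s by elim: i => //= i; apply: st.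
  have /uniq_leq_size : uniq [seq iter i h x | i <- iota 0 (size s).+1].
    rewrite map_inj_in_uniq ?iota_uniq // => i j _ _.
    wlog : i j / (i < j)%N => [th e|ij e].
      have [ij|ji|//] := ltngtP i j; first exact: th.
      by apply/esym/th.
    by have := lti i (j - i).-1; rewrite prednK ?subn_gt0 // subnKC ?(ltnW ij) // e ltxx.
  move=> /(_ s); rewrite size_map size_iota ltnn => h'; suff : false by [].
  by apply: h' => _ /mapP [i _ ->]; apply: its.
move=> fg x x0; apply/le_anti; rewrite !vg_leNgt main //=.
have [h [fh gK hK]] := fixes_inv aK fg.
by have := main h (g x) fh; rewrite gK; apply; rewrite fmorph_eq0.
Qed.

Lemma henselianS K A : henselian v K -> subfield A -> K `<=` A -> henselian v A.
Proof.
move=> [aK uK] hA KA; have aA := algebraic_closureS aK hA KA; split=> // w hw.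
by apply: uK => x /KA; apply: hw.
Qed.

(** Some x^(p^n) is u a with a in [K] and u a unit, and a p-power of the residue of u lies in the
    residue field of [K]. Hence [g] fixes the residue of u, so it acts trivially on the leading term
    of u a, and then on that of its root [x]. *)
Lemma wild_graded p K L g x : p \in [pchar (residue v)] -> henselian v K ->
  purely_wild v p K L -> fixes K g -> L x -> graded v g x.
Proof.
move=> hp hK [[_ hL KL] wv wr] fg Lx.
have vg := henselian_isometric hK fg.
have [->|x0] := eqVneq x 0; first exact: graded0.
have [n [a [Ka a0] va]] : exists n, value_group K (v x *+ (p ^ n)).
  by apply: wv; exists x.
set u := x ^+ (p ^ n) / a.
have u0 : u != 0 by rewrite mulf_neq0 ?invr_eq0 ?expf_neq0.
have vu : v u = 0 by rewrite val_div ?expf_neq0 // valX // va subrr.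
have Lu : L u by apply: (subfield_div hL); [apply: (subfieldX hL) | apply: KL].
have [t te] := vring_lift (vring_val0 u0 vu).
have [|m /(pchar_residue hp) [j ->] [b Kb]] := wr (res v t); first by exists t => //=; rewrite te.
move/eqP; rewrite -resX res_eq rmorphXn /= te => hb.
have : small v 0 ((g u) ^+ (p ^ j) - u ^+ (p ^ j)).
  have -> : g u ^+ (p ^ j) - u ^+ (p ^ j) = (val b - u ^+ (p ^ j)) - g (val b - u ^+ (p ^ j)).
    by rewrite rmorphB (fg _ Kb) rmorphXn; ring.
  by apply: smallB => //; rewrite small_isometric.
move/(small_pexp hp (vring_val0 u0 vu)) => hu.
apply: (graded_exp (k := n) hp).
have -> : x ^+ (p ^ n) = u * a by rewrite divfK.
rewrite /graded rmorphM (fg a) // -mulrBl ![_ * a]mulrC valM // smallM //.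
by apply: small_lt hu; rewrite vu.
Qed.

End ValuedAutomorphisms.

(** * Descent of graded triviality *)

Section FinitePermutations.
Variable C : closedFieldType.
Implicit Types (s : seq C) (g h : C -> C).

Definition permutes s g := {in s, forall x, g x \in s} /\ {in s &, injective g}.

Definition stabilizer s : set (C -> C) := [set g | {in s, forall x, g x = x}].

(** The default 1 is returned only when [g] does not permute [s]. *)
Definition seq_perm s g : {perm seq_sub s} :=
  odflt 1%g [pick u : {perm seq_sub s} | [forall x, val (u x) == g (val x)]].

Lemma seq_permE s g (x : seq_sub s) : permutes s g -> val (seq_perm s g x) = g (val x).
Proof.
case=> gs gi; rewrite /seq_perm; case: pickP => [u /forallP /(_ x) /eqP //|no].
pose f (y : seq_sub s) := SeqSub (gs _ (valP y)).
have fi : injective f.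
  by move=> y z /(congr1 val) /= e; apply: val_inj; apply: gi e; apply: valP.
have := no (perm fi); case/negP; apply/forallP => y.
by rewrite permE.
Qed.

Lemma permutes_comp s g h : permutes s g -> permutes s h -> permutes s (g \o h).
Proof.
move=> [gs gi] [hs hi]; split=> [x xs /=|x y xs ys /= e]; first by apply/gs/hs.
by apply: hi => //; apply: gi => //; apply: hs.
Qed.

(** The order is reversed because products of permutations act from left to right. *)
Lemma seq_perm_comp s g h : permutes s g -> permutes s h ->
  seq_perm s (g \o h) = (seq_perm s h * seq_perm s g)%g.
Proof.
move=> pg ph; apply/permP => x; apply: val_inj.
by rewrite permM !seq_permE //; apply: permutes_comp.
Qed.

Lemma eq_seq_perm s g h : permutes s g -> permutes s h ->
  seq_perm s g = seq_perm s h <-> {in s, g =1 h}.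
Proof.
move=> pg ph; split=> [e x xs|e].
  by rewrite -[x]/(val (SeqSub xs)) -!seq_permE // e.
by apply/permP => x; apply: val_inj; rewrite !seq_permE // e //; apply: valP.
Qed.

Lemma seq_perm_id s g : permutes s g -> seq_perm s g = 1%g <-> stabilizer s g.
Proof.
move=> pg; have p1 : permutes s id by split.
have <- : seq_perm s id = 1%g by apply/permP => x; apply: val_inj; rewrite seq_permE // perm1.
exact: eq_seq_perm.
Qed.

End FinitePermutations.

Section Dedekind.
Variables (C : closedFieldType) (v : valuation C).

(* The classical proof of the independence of characters, carried out on
   leading terms: subtracting suitable multiples removes the characters chi i
   one by one without changing the order of the coefficient of the identity. *)
Lemma graded_dedekind (I : finType) (P : {set I}) (T : set C)
    (chi : I -> {rmorphism C -> C}) (c : I -> C) (c0 : C) (k : vgroup v) :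
  T 1 -> (forall x y, T x -> T y -> T (x * y)) ->
  (forall i, i \in P -> isometric v (chi i)) ->
  (forall i, i \in P -> exists t, [/\ T t, t != 0 & ~~ graded v (chi i) t]) ->
  (forall t, T t -> t != 0 ->
     small v (k + v t) (c0 * t + \sum_(i in P) c i * chi i t)) ->
  small v k c0.
Proof.
move=> T1 TM; move: {2}#|P| (erefl #|P|) => n.
elim: n => [|n IH] in P c c0 k *; move=> cP vchi nchi hf.
  have := hf 1 T1 (oner_neq0 _).
  by rewrite (cards0_eq cP) big_set0 addr0 mulr1 val1 addr0.
have [j jP] : exists j, j \in P by apply/set0Pn; rewrite -card_gt0 cP.
have [u [Tu u0 ng]] := nchi j jP.
have d0 : chi j u - u != 0 by apply: contraNneq ng => e; rewrite /graded e small0.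
have [->|c0n] := eqVneq c0 0; first exact: small0.
(* Taking the relation at u t and subtracting [chi j u] times the relation at t removes the index
   [j]. *)
have h : small v (k + v u) (c0 * (u - chi j u)).
  apply: (IH (P :\ j) (fun i => c i * (chi i u - chi j u))).
  - by move: cP; rewrite (cardsD1 j) jP => -[].
  - by move=> i /setD1P [_]; apply: vchi.
  - by move=> i /setD1P [_]; apply: nchi.
  move=> t Tt t0.
  have -> : c0 * (u - chi j u) * t + \sum_(i in P :\ j) c i * (chi i u - chi j u) * chi i t
     = (c0 * (u * t) + \sum_(i in P) c i * chi i (u * t))
       - chi j u * (c0 * t + \sum_(i in P) c i * chi i t).
    rewrite !(big_setD1 j jP) /= !mulrDr !rmorphM mulr_sumr.
    rewrite [X in _ + X - _]addrC [X in _ - (_ + X)]addrC.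
    rewrite (eq_bigr (fun i => c i * chi i (u * t) - chi j u * (c i * chi i t))).
      by rewrite sumrB; ring.
    by move=> i _; rewrite rmorphM; ring.
  apply: smallB.
    by rewrite -addrA -valM //; apply: hf; [apply: TM | rewrite mulf_neq0].
  have cu0 : chi j u != 0 by rewrite fmorph_eq0.
  rewrite -addrA addrCA -(vchi j jP u u0) smallM //.
  exact: hf.
(* As [chi j] moves the leading term of [u], the factor [u - chi j u] has value at most [v u], so
   dividing by it still leaves the bound [k] for [c0]. *)
have v0 : u - chi j u != 0 by rewrite -oppr_eq0 opprB.
move: h; rewrite smallN0 ?mulf_neq0 // valM // smallN0 // => h.
rewrite -(vg_ltD2 _ _ (v u)) addrC; apply: lt_le_trans h _.
rewrite addrC ![v u + _]addrC ![_ + v c0]addrC vg_leD2.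
by move: ng; rewrite /graded -opprB smallN smallN0 // -vg_leNgt.
Qed.

End Dedekind.

Section Orbits.
Variables (C : closedFieldType) (B : set C) (aB : is_algebraic_closure B).
Variables (v : valuation C).
Hypothesis (vB : forall g : {rmorphism C -> C}, fixes B g -> isometric v g).
Implicit Types (s : seq C) (X : set (C -> C)) (x y : C) (g h : {rmorphism C -> C}).

Definition invariants X : set C := [set x | forall g, fixes B g -> X g -> g x = x].

Definition stable s := forall g, fixes B g -> {in s, forall x, g x \in s}.

(* Only the elements of X that are ring endomorphisms fixing B matter. *)
Definition subgroup X := [/\ X id,
  forall g h, fixes B g -> fixes B h -> X g -> X h -> X (g \o h)
  & forall g h, fixes B g -> fixes B h -> cancel h g -> X h -> X g].

Definition graded_faithful X :=
  forall g, fixes B g -> (forall x, invariants X x -> graded v g x) -> X g.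

Lemma stable_permutes s g : stable s -> fixes B g -> permutes s g.
Proof. by move=> st fg; split=> [|x y _ _]; [apply: st | apply: fmorph_inj]. Qed.

Lemma subgroup_stabilizer s : subgroup (stabilizer s).
Proof.
split=> [//|g h _ _ sg sh x xs /=|g h _ _ hK sh x xs]; first by rewrite sh ?sg.
by rewrite -{1}(sh x xs) hK.
Qed.

Lemma invariants_subfield X : subfield (invariants X).
Proof.
split=> [g _ _|x y hx hy g fg Xg|x y hx hy g fg Xg]; first exact: rmorph1.
  by rewrite rmorphB hx ?hy.
by rewrite fmorph_div hx ?hy.
Qed.

Lemma invariantsS X (Y : set (C -> C)) : (forall g, fixes B g -> Y g -> X g) ->
  invariants X `<=` invariants Y.
Proof. by move=> YX x hx g fg /(YX g fg); apply: hx. Qed.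

Lemma invariants_base X : B `<=` invariants X.
Proof. by move=> x Bx g fg _; apply: fg. Qed.

Lemma invariants_eq X g h x : subgroup X -> fixes B g -> fixes B h -> invariants X x ->
  (forall k : {rmorphism C -> C}, fixes B k -> cancel h k -> X (k \o g)) -> g x = h x.
Proof.
move=> hX fg fh hx hk; have [k [fk hkK khK]] := fixes_inv aB fh.
apply: (fmorph_inj k); rewrite hkK -[RHS](hx (k \o g)) //.
  exact: fixes_comp.
exact: hk.
Qed.

Lemma stabilizer_eq s g h x : stable s -> fixes B g -> fixes B h ->
  seq_perm s g = seq_perm s h -> invariants (stabilizer s) x -> g x = h x.
Proof.
move=> st fg fh e hx; apply: invariants_eq hx _ => //; first exact: subgroup_stabilizer.
move=> k fk hK y ys /=; have /eq_seq_perm := e => -> //; exact: stable_permutes.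
Qed.

(** The stabilizer of a stable list is a normal subgroup. *)
Lemma invariants_stable s g x : stable s -> fixes B g ->
  invariants (stabilizer s) x -> invariants (stabilizer s) (g x).
Proof.
move=> st fg hx h fh sh; have [k [fk gK kK]] := fixes_inv aB fg.
apply: (fmorph_inj k); rewrite gK -[RHS](hx (k \o (h \o g))) //.
  by do 2 apply: fixes_comp => //.
by move=> y ys /=; rewrite sh ?gK //; apply: st.
Qed.

Section Image.
Variables (s : seq C) (st : stable s) (X : set (C -> C)) (hX : subgroup X).

Definition perm_image : {set {perm seq_sub s}} :=
  [set u | `[<exists g, [/\ fixes B g, X g & seq_perm s g = u]>] ].

Lemma perm_imageP u :
  reflect (exists g, [/\ fixes B g, X g & seq_perm s g = u]) (u \in perm_image).
Proof. by rewrite inE; apply: asboolP. Qed.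

Lemma perm_image_group : group_set perm_image.
Proof.
have [X1 XM _] := hX; apply/group_setP; split.
  apply/perm_imageP; exists (idfun : {rmorphism C -> C}); split=> //.
  by apply/seq_perm_id => //; split.
move=> _ _ /perm_imageP [g [fg Xg <-]] /perm_imageP [h [fh Xh <-]].
apply/perm_imageP; exists (h \o g); split; first exact: fixes_comp.
  exact: XM.
by rewrite seq_perm_comp //; apply: stable_permutes.
Qed.

Canonical perm_image_as_group := Group perm_image_group.

Lemma perm_image_lift : exists r : {perm seq_sub s} -> {rmorphism C -> C},
  forall u, u \in perm_image -> [/\ fixes B (r u), X (r u) & seq_perm s (r u) = u].
Proof.
have ex u : exists g, u \in perm_image -> [/\ fixes B g, X g & seq_perm s g = u].
  have [/perm_imageP [g hg]|_] := boolP (u \in perm_image); first by exists g.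
  by exists (idfun : {rmorphism C -> C}).
by have [r hr] := choice ex; exists r.
Qed.

Lemma sum_perm_image (M : nmodType) (f : {perm seq_sub s} -> M) w : w \in perm_image ->
  \sum_(u in perm_image) f (u * w)%g = \sum_(u in perm_image) f u.
Proof.
move=> wP; rewrite [RHS](reindex_inj (mulIg w)) /=.
by apply: eq_bigl => u; rewrite (groupMr (G := perm_image_as_group)).
Qed.

End Image.

Lemma small_trace s X (r : {perm seq_sub s} -> {rmorphism C -> C}) x y :
  (forall u, u \in perm_image s X -> fixes B (r u)) -> x != 0 ->
  y = \sum_(u in perm_image s X) r u x -> small v (v y) x -> y = 0.
Proof.
move=> fr x0 ey h; apply: (small_self (v := v)); rewrite {2}ey.
by apply: small_sum => u uP; rewrite small_isometric //; apply/vB/fr.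
Qed.

(** A nonzero trace of [x] has value at least [v x], so a bound relative to its own value is also
    one relative to [v x]. *)
Lemma graded_trace s X (r : {perm seq_sub s} -> {rmorphism C -> C}) g x y :
  (forall u, u \in perm_image s X -> fixes B (r u)) -> x != 0 ->
  y = \sum_(u in perm_image s X) r u x -> graded v g y -> small v (v x) (g y - y).
Proof.
move=> fr x0 ey gy; have [e|y0] := eqVneq y 0.
  by rewrite e rmorph0 subrr small0.
apply: small_lt gy; rewrite vg_leNgt; apply/negP => lt.
by move/eqP: y0; apply; apply: small_trace ey _ => //; rewrite smallN0.
Qed.

(* If g outside X acted trivially on the leading terms of the invariants of X,
   hence of traces, the characters of the cosets of X and g X would be dependent. *)
Lemma graded_faithfulS s X : stable s -> subgroup X ->
  (forall g, fixes B g -> stabilizer s g -> X g) ->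
  graded_faithful (stabilizer s) -> graded_faithful X.
Proof.
move=> st hX sX fs g fg hg; apply: contrapT => nXg.
have [X1 XM XV] := hX; pose P := perm_image_as_group st hX.
have pf (k : {rmorphism C -> C}) : fixes B k -> permutes s k by exact: stable_permutes.
set w := seq_perm s g.
(* If [g] permuted [s] as some h in [X] does, then g h^-1 would fix [s] and so lie in [X]. *)
have wP : w \notin P.
  apply/negP => /perm_imageP [h [fh Xh e]]; apply: nXg.
  have [k [fk hK kK]] := fixes_inv aB fh.
  have -> : (g : C -> C) = (g \o k) \o h by apply/funext => x /=; rewrite hK.
  apply: XM Xh => //; first exact: fixes_comp.
  apply: (sX (g \o k)); first exact: fixes_comp.
  move=> x xs /=; have [kf _] := pf k fk.
  have /eq_seq_perm <- // := e; rewrite ?kK //; [exact: pf | exact: pf | exact: kf].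
have hT : subgroup setT by [].
have [r hr] := perm_image_lift s setT.
have inT (k : {rmorphism C -> C}) : fixes B k -> seq_perm s k \in perm_image s setT.
  by move=> fk; apply/perm_imageP; exists k.
have PT u : u \in P -> u \in perm_image s setT.
  by move=> /perm_imageP [k [fk _ <-]]; apply: inT.
pose T := invariants (stabilizer s).
have tr x : T x -> g (\sum_(u in P) r u x) = \sum_(u in P) r (u * w)%g x.
  move=> Tx; rewrite rmorph_sum; apply: eq_bigr => u uP.
  have [f1 _ e1] := hr _ (PT _ uP).
  have [|f2 _ e2] := hr (u * w)%g.
    by rewrite -e1 -seq_perm_comp; [apply/inT/fixes_comp | exact: pf | exact: pf].
  rewrite -[LHS]/((g \o r u) x); apply: (stabilizer_eq st) Tx => //.
    exact: fixes_comp.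
  by rewrite seq_perm_comp ?e1 ?e2 //; exact: pf.
have r1 x : T x -> r 1%g x = x.
  move=> Tx; have [|f1 _ e1] := hr 1%g.
    by apply/perm_imageP; exists (idfun : {rmorphism C -> C}); split=> //; apply/seq_perm_id; split.
  rewrite -[RHS]/((idfun : {rmorphism C -> C}) x).
  by apply: (stabilizer_eq st) Tx => //; rewrite e1; apply/esym/seq_perm_id; split.
have wT : w \in perm_image s setT by exact: inT.
pose PT' := perm_image_as_group st hT.
have PwT u : u \in P -> (u * w)%g \in perm_image s setT.
  by move=> uP; apply: (groupM (G := PT')) wT; apply: PT.
(* The dependent characters: those of [P] with coefficient 1 and those of its translate by [w] with
   coefficient -1, the identity being set aside. *)
pose Q := ((P :|: [set (u * w)%g | u in P]) :\ 1%g)%SET.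
pose c (u : {perm seq_sub s}) : C := if u \in P then 1 else -1.
have QT u : u \in Q -> u \in perm_image s setT.
  by case/setD1P => _ /setUP [/PT //|/imsetP [u' uP' ->]]; apply: PwT.
have sumQ x : T x -> 1 * x + \sum_(u in Q) c u * r u x =
    \sum_(u in P) r u x - \sum_(u in P) r (u * w)%g x.
  move=> Tx; have dis : fintype.disjoint (mem P) (mem [set (u * w)%g | u in P]%SET).
    rewrite finset.disjoints_subset; apply/fintype.subsetP => u uP.
    rewrite finset.in_setC; apply/negP.
    by case/imsetP => u' uP' e; case/negP: wP; rewrite -(groupMl _ uP') -e.
  have c1 : c 1%g = 1 by rewrite /c group1.
  rewrite -{1}(r1 x Tx) -{1}c1 -big_setD1 /=; last by rewrite finset.in_setU group1.
  rewrite (eq_bigl _ _ (fun u => finset.in_setU u P _)) (bigU _ _ _ dis) /=; congr (_ + _).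
    by apply: eq_bigr => u uP; rewrite /c uP mul1r.
  rewrite big_imset /=; last by move=> u u' _ _; apply: mulIg.
  rewrite -sumrN; apply: eq_bigr => u uP.
  by rewrite /c (groupMl _ uP) (negPf wP) mulN1r.
(* At x the relation is tr x - g (tr x), small relative to [v x] because tr x is invariant under
   [X]. Dedekind's lemma then makes the coefficient 1 of the identity small, which is absurd. *)
have s1 : small v 0 (1 : C).
  apply: (graded_dedekind (P := Q) (T := T) (chi := r) (c := c)).
  - exact: (subfield1 (invariants_subfield _)).
  - by move=> x y; apply: (subfieldM (invariants_subfield _)).
  - by move=> u /QT /hr [fu _ _]; apply: vB.
  - move=> u uQ; apply: contrapT => no; have [fu _ eu] := hr _ (QT _ uQ).
    have : stabilizer s (r u).
      apply: fs => // x Tx; have [->|x0] := eqVneq x 0; first exact: graded0.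
      by apply: contrapT => /negP ng; apply: no; exists x.
    move/(seq_perm_id (pf _ fu)); rewrite eu => u1.
    by move: uQ; rewrite u1 !inE eqxx.
  move=> x Tx x0; rewrite add0r sumQ // -tr // -opprB smallN.
  apply: (graded_trace (s := s) (X := X) (r := r)) => //.
    by move=> u /PT /hr [].
  apply: hg => h fh Xh; rewrite rmorph_sum /=.
  have hP : seq_perm s h \in P by apply/perm_imageP; exists h.
  rewrite -[RHS](sum_perm_image st hX _ hP); apply: eq_bigr => u uP.
  have [f1 _ e1] := hr _ (PT _ uP).
  have [|f2 _ e2] := hr (u * seq_perm s h)%g; first by apply: PT; rewrite groupM.
  rewrite -[LHS]/((h \o r u) x); apply: (stabilizer_eq st) Tx => //.
    exact: fixes_comp.
  by rewrite seq_perm_comp ?e1 ?e2 //; exact: pf.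
by move: s1; rewrite /small oner_eq0 val1 ltxx.
Qed.

(* For t invariant under the stabilizer of s, rho moves the traces of x * t down
   to the invariants of X only to higher order; [graded_dedekind] extracts the
   term of the identity from these traces. *)
Lemma graded_compositum s X (rho : {rmorphism C -> C}) x :
  stable s -> graded_faithful (stabilizer s) ->
  subgroup X -> (forall g y, fixes B g -> invariants X y -> graded v g y) ->
  fixes B rho -> stabilizer s rho -> invariants (X `&` stabilizer s) x ->
  graded v rho x.
Proof.
move=> st fs hX gX frho srho hx; have [->|x0] := eqVneq x 0; first exact: graded0.
have [X1 XM XV] := hX; pose P := perm_image_as_group st hX.
have pf (k : {rmorphism C -> C}) : fixes B k -> permutes s k by exact: stable_permutes.
have [r hr] := perm_image_lift s X; pose T := invariants (stabilizer s).
(* Elements of [X] act on this field through their permutation of [s] alone. *)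
have agree g h y : fixes B g -> fixes B h -> X g -> X h -> seq_perm s g = seq_perm s h ->
    invariants (X `&` stabilizer s) y -> g y = h y.
  move=> fg fh Xg Xh e hy; have [k [fk hK kK]] := fixes_inv aB fh.
  apply: (fmorph_inj k); rewrite hK -[RHS](hy (k \o g)) //; first exact: fixes_comp.
  split; first by apply: XM => //; apply: XV Xh.
  move=> z zs /=; have /eq_seq_perm := e => -> //; exact: pf.
have Tinv : T `<=` invariants (X `&` stabilizer s) by apply: invariantsS => g _ [].
have hS := invariants_subfield (X `&` stabilizer s).
have r1 y : invariants (X `&` stabilizer s) y -> r 1%g y = y.
  move=> hy; have [|f1 X1' e1] := hr 1%g; first exact: (group1 P).
  rewrite -[RHS]/((idfun : {rmorphism C -> C}) y); apply: agree hy => //.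
  by rewrite e1; apply/esym/seq_perm_id; split.
have sh : small v (v x) (rho (r 1%g x) - r 1%g x).
  apply: (graded_dedekind (P := (P :\ 1%g)%SET) (T := T) (chi := r)
    (c := fun u => rho (r u x) - r u x)).
  - exact: (subfield1 (invariants_subfield _)).
  - by move=> y z; apply: (subfieldM (invariants_subfield _)).
  - by move=> u /setD1P [_] /hr [fu _ _]; apply: vB.
  - move=> u /setD1P [u1 uP]; apply: contrapT => no; have [fu _ eu] := hr _ uP.
    have : stabilizer s (r u).
      apply: fs => // y Ty; have [->|y0] := eqVneq y 0; first exact: graded0.
      by apply: contrapT => /negP ng; apply: no; exists y.
    by move/(seq_perm_id (pf _ fu)); rewrite eu => e; rewrite e eqxx in u1.
  move=> t Tt t0; pose y := \sum_(u in P) r u (x * t).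
  (* [rho] fixes every [r u t], as these are invariant under the stabilizer of [s]. The sum is
     therefore [rho y - y], with y a trace and hence an invariant of [X]. *)
  have -> : (rho (r 1%g x) - r 1%g x) * t
      + \sum_(u in (P :\ 1%g)%SET) (rho (r u x) - r u x) * r u t = rho y - y.
    rewrite -{1}(r1 t (Tinv _ Tt)).
    rewrite -(big_setD1 1%g (F := fun u => (rho (r u x) - r u x) * r u t)) ?group1 //.
    rewrite /y rmorph_sum -sumrB; apply: eq_bigr => u uP.
    have [fu _ _] := hr _ uP.
    rewrite !rmorphM mulrBl; congr (_ - _); congr (_ * _).
    by rewrite (invariants_stable st fu Tt).
  rewrite -valM //; apply: (graded_trace (s := s) (X := X) (r := r)) => //.
  - by move=> u /hr [].
  - by rewrite mulf_neq0.
  apply: gX => // h fh Xh; rewrite rmorph_sum /=.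
  have hP : seq_perm s h \in P by apply/perm_imageP; exists h.
  rewrite -[RHS](sum_perm_image st hX _ hP); apply: eq_bigr => u uP.
  have [f1 Xu e1] := hr _ uP.
  have [|f2 Xu2 e2] := hr (u * seq_perm s h)%g; first by rewrite (groupM (G := P)).
  rewrite -[LHS]/((h \o r u) (x * t)); apply: agree => //.
  - exact: fixes_comp.
  - exact: XM.
  - by rewrite seq_perm_comp ?e1 ?e2 //; exact: pf.
  by apply: (subfieldM hS) => //; apply: Tinv.
by move: sh; rewrite r1.
Qed.

End Orbits.

HB.instance Definition _ (R : fieldType) (v : valuation R) :=
  GRing.isZmodMorphism.Build (vring_of v) (residue v) (res v) (@resB R v).

Lemma res_monoid_morphism (R : fieldType) (v : valuation R) : monoid_morphism (res v).
Proof. by split; [exact: (@res_nat R v 1) | exact: resM]. Qed.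

HB.instance Definition _ (R : fieldType) (v : valuation R) :=
  GRing.isMonoidMorphism.Build (vring_of v) (residue v) (res v) (res_monoid_morphism v).

(** * Tame extensions *)

(** Translation by [h] permutes the cosets of [G]. In the sum of the elements h + t_i - t_w(i) of
    [G] the representatives cancel, and n h remains. *)
Lemma group_index_mulrn (V : zmodType) (G H : set V) n h :
  (forall x y, G x -> G y -> G (x - y)) -> (forall x y, H x -> H y -> H (x + y)) ->
  group_index G H n -> H h -> G (h *+ n).
Proof.
move=> GB HD [t Ht tu] Hh.
have /choice [w hw] : forall i, exists j, G (h + t i - t j).
  by move=> i; have [j [hj _]] := tu _ (HD _ _ Hh (Ht i)); exists j.
have wi : injective w.
  move=> i j e; have := GB _ _ (hw i) (hw j).
  rewrite e opprB addrA subrK opprD addrACA subrr add0r => Gij.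
  have [k [_ un]] := tu _ (Ht i); rewrite -(un i); first exact: un.
  by rewrite subrr -(subrr (t i - t j)); apply: GB.
have G0 : G 0 by have [i [Gi _]] := tu _ Hh; rewrite -(subrr (h - t i)); apply: GB.
have GD x y : G x -> G y -> G (x + y).
  by move=> Gx Gy; rewrite -[y]opprK; apply: (GB _ _ Gx); rewrite -sub0r; apply: GB.
have -> : h *+ n = \sum_i (h + t i - t (w i)).
  rewrite sumrB big_split /= sumr_const card_ord (reindex_inj wi) /=.
  by rewrite addrK.
by elim/big_ind: _.
Qed.

(** A free family with as many elements as a basis spans: its square coordinate matrix over [A] has
    trivial kernel. *)
Lemma basis_independent (C : fieldType) (A M : set C) n (b : 'I_n -> C) (I : finType)
    (z : I -> C) : subfield A -> is_basis A M b -> #|I| = n ->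
  (forall i, M (z i)) ->
  (forall c, (forall i, A (c i)) -> \sum_i c i * z i = 0 -> forall i, c i = 0) ->
  forall x, M x -> exists2 c : I -> C, (forall i, A (c i)) & x = \sum_i c i * z i.
Proof.
move=> hA [_ gb _] In Mz iz.
have /choice [m hm] : forall i, exists m : 'I_n -> subfield_of hA, z i = \sum_l val (m l) * b l.
  move=> i; have [c Ac ->] := gb _ (Mz i).
  have [d hd] := choice (fun l => sfval_lift hA (Ac l)).
  by exists d; apply: eq_bigr => l _; rewrite hd.
pose D := \matrix_(k < #|I|, l < n) m (enum_val k) l.
have lin (u : 'rV_#|I|) : \sum_k val (u 0 k) * z (enum_val k) = \sum_l val ((u *m D) 0 l) * b l.
  under eq_bigr do rewrite hm mulr_sumr; rewrite exchange_big; apply: eq_bigr => l _.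
  rewrite mxE rmorph_sum mulr_suml; apply: eq_bigr => k _.
  by rewrite mxE rmorphM mulrA.
have reind (c : I -> C) : \sum_i c i * z i = \sum_(k < #|I|) c (enum_val k) * z (enum_val k).
  by rewrite (reindex _ (onW_bij _ (enum_val_bij I))).
have free : row_free D.
  apply: inj_row_free => u u0.
  have h := iz (fun i => val (u 0 (enum_rank i))) (fun i => sfvalP _).
  have := h _ (enum_val _); rewrite reind => h'.
  apply/rowP => k; rewrite mxE; apply: val_inj; rewrite rmorph0 -[k]enum_valK h' //.
  under eq_bigr do rewrite enum_valK.
  by rewrite lin u0 big1 // => l _; rewrite mxE rmorph0 mul0r.
move=> x /gb [c Ac ->]; have [d hd] := choice (fun l => sfval_lift hA (Ac l)).
have full : row_full D by rewrite /row_full (eqP free) In.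
have /submxP [u hu] := submx_full (\row_l d l) full.
exists (fun i => val (u 0 (enum_rank i))) => [i|]; first exact: sfvalP.
rewrite reind; under [RHS]eq_bigr do rewrite enum_valK.
by rewrite lin -hu; apply: eq_bigr => l _; rewrite mxE hd.
Qed.

(** * Hensel's lemma and roots of order prime to p *)

Section Hensel.
Variables (C : closedFieldType) (v : valuation C).
Implicit Types (A K M : set C) (x y z : C) (f : {poly C}) (g : {rmorphism C -> C}).

Lemma small_unit x y : x \in vring v -> small v 0 (x * y) -> small v 0 x \/ small v 0 y.
Proof.
have [->|x0] := eqVneq x 0; first by rewrite small0; left.
move=> vx; have [|nx] := boolP (small v 0 x); first by left.
rewrite -[X in small v X (x * y)]addr0 -[X in small v (X + _)](unit_val x0 vx nx).
by rewrite smallM //; right.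
Qed.

Lemma integral_root f z : f \is monic -> f \is a polyOver (vring v) -> root f z -> z \in vring v.
Proof.
move=> mf vf /rootP fz; have [->|z0] := eqVneq z 0; first exact: rpred0.
rewrite vringN0 // vg_leNgt; apply/negP => lt.
have sf : size f = (size f).-1.+1 by rewrite prednK // lt0n size_poly_eq0 monic_neq0.
set n := (size f).-1 in sf; have : small v (v (z ^+ n)) (z ^+ n).
  have : \sum_(i < n) f`_i * z ^+ i + z ^+ n = 0.
    rewrite -[RHS]fz horner_coef sf big_ord_recr /=; congr (_ + _).
    by have := monicP mf; rewrite lead_coefE -/n => ->; rewrite mul1r.
  move/eqP; rewrite addrC addr_eq0 => /eqP e; rewrite {2}e smallN.
  apply: small_sum => i _; apply: smallMl; first by move/polyOverP: vf; apply.
  rewrite smallN0 ?expf_neq0 // !valX //.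
  case: i => i /= lt_in; rewrite -(subnK lt_in) addnS -addSn mulrnDr addrC.
  rewrite -[X in _ < X]addr0 vg_ltD2.
  exact: vg_mulrn_lt0.
by move/small_self/eqP; rewrite expf_eq0 (negPf z0) andbF.
Qed.

(** [f] splits over [C]. As its value at [x0] is small, some root z is congruent to [x0], and only
    one is, since the derivative is not small there. Automorphisms over [A] are isometric and fix
    [x0], so they fix z; a fixed simple root lies in [A]. *)
Lemma hensel A f x0 : is_algebraic_closure A ->
  (forall g, fixes A g -> isometric v g) ->
  f \is monic -> f \is a polyOver (vring v) -> coefs_in A f ->
  A x0 -> x0 \in vring v -> small v 0 f.[x0] -> ~~ small v 0 f^`().[x0] ->
  exists z, [/\ A z, z \in vring v, small v 0 (z - x0), root f z
    & forall y, root f y -> small v 0 (y - x0) -> y = z].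
Proof.
move=> aA vA mf vf cf Ax vx sfx nd.
have [rs] := closed_field_poly_normal f; rewrite (monicP mf) scale1r => fE.
have rsE z : (z \in rs) = root f z by rewrite fE root_prod_XsubC.
have vrs z : z \in rs -> z \in vring v by rewrite rsE; apply: integral_root.
have [z zrs sz] : exists2 z, z \in rs & small v 0 (z - x0).
  move: sfx; rewrite fE horner_prod.
  elim: (rs) vrs => [|z r IH] vr; first by rewrite big_nil /small oner_eq0 val1 ltxx.
  rewrite big_cons hornerXsubC => /small_unit [].
  - by rewrite rpredB // vr ?mem_head.
  - by rewrite -smallN opprB; exists z; rewrite ?mem_head.
  case/IH => [y yr|y yr sy]; first by rewrite vr // in_cons yr orbT.
  by exists y; rewrite // in_cons yr orbT.
set q := \prod_(y <- rem z rs) ('X - y%:P).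
have fq : f = ('X - z%:P) * q by rewrite fE (perm_big _ (perm_to_rem zrs)) big_cons.
have uniq1 y : y \in rem z rs -> small v 0 (y - x0) -> False.
  move=> yr sy; case/negP: nd.
  rewrite fq /q (perm_big _ (perm_to_rem yr)) big_cons; set h := \prod_(_ <- _) _.
  have vh : h \is a polyOver (vring v).
    rewrite /h big_seq; apply: rpred_prod => w /mem_rem /mem_rem wr.
    by rewrite polyOverXsubC vrs.
  move: ('X - z%:P) ('X - y%:P) (derivXsubC z) (derivXsubC y) (hornerXsubC z x0)
    (hornerXsubC y x0) => lz ly dz dy ez ey.
  rewrite !derivM dz dy !mul1r !(hornerM, hornerD) ez ey.
  rewrite -opprB smallN in sz; rewrite -opprB smallN in sy.
  have hx : h.[x0] \in vring v by apply: rpred_horner.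
  have dhx : h^`().[x0] \in vring v by apply: rpred_horner; rewrite ?polyOver_deriv.
  have vzx := small_vring sz; have vyx := small_vring sy.
  apply: smallD; first by rewrite mulrC; apply: smallMl.
  rewrite mulrC; apply: smallMl => //; apply: rpredD => //.
  by apply: rpredM.
have unique y : root f y -> small v 0 (y - x0) -> y = z.
  rewrite -rsE (perm_mem (perm_to_rem zrs)) in_cons => /orP [/eqP //|yr sy].
  by case: (uniq1 y yr sy).
exists z; split=> //; [|exact: vrs | by rewrite -rsE].
apply: (fixed_simple_root (f := f)) => //; [| by rewrite -rsE |].
  move=> g fg; apply: unique; first by apply: (fixes_root fg) => //; rewrite -rsE.
  by rewrite -(fg x0 Ax) -rmorphB small_isometric //; apply: vA.
rewrite fq derivM derivXsubC mul1r hornerD hornerM hornerXsubC subrr mul0r addr0.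
apply/negP; rewrite -/(root q z) root_prod_XsubC => zr.
exact: uniq1 zr sz.
Qed.

Section TameRoots.
Variables (p : nat) (hp : p \in [pchar (residue v)]).

(** Otherwise the sum of the y^i for i < e would vanish, whereas it is congruent to [e], a unit. *)
Lemma unit_root_small e y : ~~ (p %| e)%N -> small v 0 (y - 1) -> y ^+ e = 1 -> y = 1.
Proof.
move=> pe sy ye; apply/eqP; rewrite -subr_eq0.
have := subrX1 y e; rewrite ye subrr => /esym/eqP; rewrite mulf_eq0 => /orP [//|/eqP s0].
case/negP: pe; rewrite -(small_nat hp).
have vy : y \in vring v by rewrite -[y](subrK 1) rpredD ?rpred1 // small_vring.
have -> : e%:R = - \sum_(i < e) (y ^+ i - 1).
  by rewrite sumrB s0 sub0r opprK sumr_const card_ord.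
rewrite smallN; apply: small_sum => i _; rewrite subrX1 mulrC.
by apply: smallMl => //; apply: rpred_sum => j _; apply: rpredX.
Qed.

Lemma small_root_exists A e y : is_algebraic_closure A ->
  (forall g, fixes A g -> isometric v g) -> A y -> ~~ (p %| e)%N -> small v 0 (y - 1) ->
  exists z, [/\ A z, small v 0 (z - 1) & z ^+ e = y].
Proof.
move=> aA vA Ay pe sy.
have e0 : (0 < e)%N by rewrite lt0n; apply: contraNneq pe => ->; apply: dvdn0.
have vy : y \in vring v by rewrite -[y](subrK 1) rpredD ?rpred1 // small_vring.
have [z [Az _ sz rz _]] : exists z, [/\ A z, z \in vring v, small v 0 (z - 1),
    root ('X^e - y%:P) z & forall w, root ('X^e - y%:P) w -> small v 0 (w - 1) -> w = z].
  apply: hensel => //.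
  - exact: monicXnsubC.
  - by rewrite rpredB ?rpredX ?polyOverX ?polyOverC.
  - move=> i; rewrite coefB coefXn coefC; apply: (subfieldB aA.1).
      exact: (subfield_nat aA.1).
    by case: ifP => _ //; apply: (subfield0 aA.1).
  - exact: (subfield1 aA.1).
  - exact: rpred1.
  - by rewrite hornerD hornerN hornerXn hornerC expr1n -opprB smallN.
  by rewrite derivB derivXn derivC subr0 hornerMn hornerXn expr1n (small_nat hp).
exists z; split=> //; apply/eqP; rewrite -subr_eq0.
by move: rz; rewrite rootE hornerD hornerN hornerXn hornerC.
Qed.

End TameRoots.
End Hensel.

Section Tame.
Variables (C : closedFieldType) (v : valuation C).
Implicit Types (A K M : set C) (x y z : C) (f : {poly C}) (g : {rmorphism C -> C}).

Lemma residue_subfield A : subfield A -> subfield (residue_field (v := v) A).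
Proof.
move=> hA; split.
- exists 1; last by rewrite rmorph1.
  by change (A (val (1 : vring_of v))); rewrite rmorph1; apply: (subfield1 hA).
- move=> _ _ [a Aa <-] [b Ab <-]; exists (a - b); last by rewrite rmorphB.
  by change (A (val (a - b))); rewrite rmorphB; apply: (subfieldB hA).
move=> _ _ [a Aa <-] [b Ab <-]; have [b0|b0] := eqVneq (res v b) 0.
  exists 0; first by change (A (val (0 : vring_of v))); rewrite rmorph0; apply: (subfield0 hA).
  by rewrite b0 invr0 mulr0 rmorph0.
have nb : val b != 0 by apply: contraNneq b0 => e; rewrite res_small e small0.
have vb : v (val b) = 0.
  by apply: unit_val => //; [apply: (valP b) | rewrite -res_small].
have [t te] : exists t : vring_of v, val t = (val b)^-1.
  by apply: vring_lift; apply: vring_val0; rewrite ?invr_eq0 // valV // vb oppr0.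
exists (a * t); first by change (A (val (a * t))); rewrite rmorphM /= te; apply: (subfield_div hA).
rewrite rmorphM; congr (_ * _); apply: (mulfI b0); rewrite mulfV // -rmorphM.
have -> : b * t = 1 by apply: val_inj; rewrite rmorphM /= te mulfV // rmorph1.
exact: rmorph1.
Qed.

Lemma exists_min (I : finType) (P : pred I) (F : I -> vgroup v) i0 : P i0 ->
  exists2 i, P i & forall j, P j -> F i <= F j.
Proof.
move=> Pi0; have tot : total (<=%O : rel (vgroup v)) by exact: vgroup_total.
by case: (extremumP F (@lexx _ _) (@le_trans _ _) tot Pi0) => i Pi hi; exists i.
Qed.

(** A nonzero term of least value cannot be cancelled by the others. *)
Lemma sum_distinct (I : finType) (a : I -> C) :
  (forall i j, a i != 0 -> a j != 0 -> v (a i) = v (a j) -> i = j) ->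
  \sum_i a i = 0 -> forall i, a i = 0.
Proof.
move=> dis s0 i; apply/eqP/negPn/negP => ai.
have [j aj hj] := exists_min (fun j => v (a j)) (P := fun j => a j != 0) ai.
move: s0; rewrite (bigD1 j) //= => /eqP; rewrite addr_eq0 => /eqP e.
move/eqP: (aj); apply; apply: (small_self (v := v)); rewrite {2}e smallN.
apply: small_sum => k kj; have [->|ak] := eqVneq (a k) 0; first exact: small0.
rewrite smallN0 // lt_neqAle hj // andbT; apply: contra kj => /eqP e'.
by apply/eqP; apply: dis.
Qed.

Lemma graded_small g x : x \in vring v -> graded v g x -> small v 0 (g x - x).
Proof.
have [->|x0] := eqVneq x 0; first by rewrite rmorph0 subrr small0.
by rewrite vringN0 // => vx; apply: small_lt.
Qed.

Section Fixed.
Variables (p : nat) (hp : p \in [pchar (residue v)]).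
Variables (K M : set C) (hK : henselian v K) (hM : subfield M) (KM : K `<=` M).
Variables (g : {rmorphism C -> C}) (fg : fixes K g).
Hypothesis gM : forall x, M x -> graded v g x.

Let vK (h : {rmorphism C -> C}) : fixes K h -> isometric v h.
Proof. exact: henselian_isometric. Qed.
Let aM : is_algebraic_closure M := algebraic_closureS hK.1 hM KM.
Let vM (h : {rmorphism C -> C}) : fixes M h -> isometric v h.
Proof. by move/(fixesS KM); apply: vK. Qed.

(** Lift the minimal polynomial of the residue to a monic polynomial over [K]. By Hensel's lemma it
    has a unique root in the residue class; [g] maps this root to a root, in the same class because
    [g] acts trivially on leading terms. *)
Lemma separable_residue_fixed (r : vring_of v) : M (val r) ->
  separable_element (residue_field (v := v) K) (res v r) ->
  exists t : vring_of v, [/\ M (val t), g (val t) = val t & res v t = res v r].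
Proof.
move=> Mr [q [[mq cq rq _] sq]].
pose n := (size q).-1; have sn : size q = n.+1.
  by rewrite prednK // lt0n size_poly_eq0 monic_neq0.
(* The leading coefficient is lifted to 1, so that the lift is monic of the same degree. *)
have /choice [c hc] : forall i, exists a : vring_of v,
    [/\ K (val a), res v a = q`_i & i = n -> a = 1].
  move=> i; have [->|ni] := eqVneq i n.
    exists 1; split=> //; first exact: (subfield1 hK.1.1).
    by rewrite rmorph1 -(monicP mq) lead_coefE.
  by have [a Ka ra] := cq i; exists a; split=> // e; rewrite e eqxx in ni.
pose F := \poly_(i < n.+1) c i.
have F0 : c n != 0 by have [_ _ ->] := hc n; rewrite ?oner_neq0.
have sF : size F = n.+1 by apply: size_poly_eq.
have lF : lead_coef F = 1 by rewrite lead_coef_poly //; have [_ _ ->] := hc n.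
have mF : F \is monic by rewrite monicE lF.
have qF : map_poly (res v) F = q.
  apply/polyP => i; rewrite coef_map coef_poly /=; case: ltnP => hi; first by have [_ ->] := hc i.
  by rewrite rmorph0 nth_default // sn.
pose f := map_poly (val : {rmorphism vring_of v -> C}) F.
have K0 : K (val (0 : vring_of v)) by rewrite rmorph0; apply: (subfield0 hK.1.1).
have Kf i : K f`_i.
  by rewrite coef_map coef_poly; case: ltnP => _; [have [] := hc i | exact: K0].
have fr s : f.[val s] = val F.[s] by rewrite horner_map.
have [z [Mz vz sz rz uz]] : exists z, [/\ M z, z \in vring v, small v 0 (z - val r), root f z
    & forall y, root f y -> small v 0 (y - val r) -> y = z].
  apply: hensel => //.
  - exact: monic_map.
  - by apply/polyOverP => i; rewrite coef_map; apply: (valP F`_i).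
  - by move=> i; apply/KM/Kf.
  - exact: (valP r).
  - by rewrite fr -res_small -horner_map /= qF; apply/eqP/rootP.
  rewrite deriv_map horner_map -res_small -horner_map /= -deriv_map qF.
  by rewrite separable_poly.unlock in sq; apply: coprimep_root sq rq.
have [t te] := vring_lift vz; exists t; rewrite te; split=> //; last first.
  by apply/eqP; rewrite res_eq te.
apply: uz.
  exact: (fixes_root fg).
have -> : g z - val r = (g z - z) + (z - val r) by ring.
by apply: smallD => //; apply: graded_small => //; apply: gM.
Qed.

(** Write x^e = a u with a in [K] and u a unit. Some z fixed by [g] has the residue of u, and u / z
    has an e-th root w congruent to 1. Then y = x / w satisfies y^e = a z, which is fixed, so g(y) /
    y is an e-th root of unity congruent to 1. *)
Lemma tame_value_fixed x e : x != 0 -> M x -> ~~ (p %| e)%N ->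
  value_group K (v x *+ e) ->
  separable_extension (residue_field (v := v) K) (residue_field M) ->
  exists y, [/\ y != 0, M y, g y = y & v y = v x].
Proof.
move=> x0 Mx pe [a [Ka a0] va] sM.
set u := x ^+ e / a.
have xe0 : x ^+ e != 0 by rewrite expf_neq0.
have u0 : u != 0 by rewrite mulf_neq0 ?invr_eq0.
have vu : v u = 0 by rewrite val_div // valX // va subrr.
have Mu : M u by apply: (subfield_div hM); [apply: (subfieldX hM) | apply: KM].
have [r re] := vring_lift (vring_val0 u0 vu).
have [||t [Mt gt rt]] := @separable_residue_fixed r; rewrite ?re //.
  by apply: sM; exists r => //=; rewrite re.
set z := val t in Mt gt.
have [z0 vz] : z != 0 /\ v z = v u.
  by apply: small_val => //; rewrite vu -re -res_eq rt.
have sy : small v 0 (u / z - 1).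
  rewrite -(smallM 0 _ z0) addr0 vz vu mulrBr mulr1 mulrC divfK // -opprB smallN.
  by rewrite -re -res_eq rt.
have [w [Mw sw we]] := small_root_exists hp aM vM (subfield_div hM Mu Mt) pe sy.
have [w0 vw] := small_val (oner_neq0 C) (etrans (congr1 (fun k => small v k (w - 1)) (val1 v)) sw).
rewrite val1 in vw.
have [y0 My ye] : [/\ x / w != 0, M (x / w) & (x / w) ^+ e = a * z].
  split; first by rewrite mulf_neq0 ?invr_eq0.
    exact: (subfield_div hM).
  rewrite expr_div_n we /u; field.
  by rewrite a0 xe0 z0.
exists (x / w); split=> //; last by rewrite val_div // vw subr0.
have : g (x / w) / (x / w) = 1.
  apply: (unit_root_small hp pe); first by rewrite -graded_ratio //; apply: gM.
  rewrite expr_div_n -rmorphXn ye rmorphM gt (fg Ka) divff // mulf_neq0 //.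
by move/(congr1 (fun t => t * (x / w))); rewrite divfK // mul1r.
Qed.

End Fixed.

(* A tame extension has a basis over K made of products of lifts of residues
   and of values; for an automorphism acting trivially on leading terms, Hensel's
   lemma provides fixed lifts, so such an automorphism is trivial. *)
Lemma tame_graded_fixed p K F D g x : p \in [pchar (residue v)] -> henselian v K ->
  tame v p K F -> F x -> fixes K g -> subfield D -> K `<=` D -> D x ->
  (forall y, D y -> graded v g y) -> g x = x.
Proof.
move=> hp hK [[hsK hF KF] tF] Fx fg hD KD Dx gD.
(* K(x) lies in [F], where tameness applies, and in [D], where [g] is trivial on leading terms. *)
have [M [hM KM Mx fM sM]] := simple_extension hsK (hK.1.2 x).
have [sepM [e [f [ge [b bM bu] pe dM]]]] := tF M (And3 hsK hM KM) (sM F hF KF Fx) fM.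
have gM y : M y -> graded v g y by move/(sM D hD KD Dx)/gD.
have hk := residue_subfield hsK; have hm := residue_subfield hM.
have df : degree (residue_field (v := v) K) (residue_field M) f by exists b.
have [c [cM cg ci]] := basis_degree hk (subfield0 hm) df.
have [d hd] := basis_degree hsK (subfield0 hM) dM.
have /choice [s hs] : forall i, exists t : vring_of v,
    [/\ M (val t), g (val t) = val t & res v t = c i].
  move=> i; have [t Mt tE] := cM i; rewrite -tE.
  apply: (separable_residue_fixed hK hM KM fg gM Mt).
  by rewrite tE; apply: sepM.
have [t tM tu] := ge.
have vgB (A : set C) : subfield A -> forall k l,
    value_group A k -> value_group (v := v) A l -> value_group A (k - l).
  move=> hA _ _ [y [Ay y0] <-] [z [Az z0] <-]; exists (y / z); last by rewrite val_div.
  by split; [apply: (subfield_div hA) | rewrite mulf_neq0 ?invr_eq0].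
have vgD (A : set C) : subfield A -> forall k l,
    value_group A k -> value_group (v := v) A l -> value_group A (k + l).
  move=> hA _ _ [y [Ay y0] <-] [z [Az z0] <-]; exists (y * z); last by rewrite valM.
  by split; [apply: (subfieldM hA) | rewrite mulf_neq0].
have /choice [r hr] : forall j, exists y, [/\ y != 0, M y, g y = y & v y = t j].
  move=> j; have [y [My y0] <-] := tM j.
  apply: (tame_value_fixed hp hK hM KM fg gM y0 My pe) => //.
  apply: (group_index_mulrn (vgB K hsK) (vgD M hM) ge).
  by exists y.
pose z (ij : 'I_f * 'I_e) := val (s ij.1) * r ij.2.
have Mz ij : M (z ij).
  by apply: (subfieldM hM); [have [] := hs ij.1 | have [] := hr ij.2].
have gz ij : g (z ij) = z ij.
  by rewrite rmorphM; have [_ -> _] := hs ij.1; have [_ _ -> _] := hr ij.2.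
(* A combination over [K] of lifts of a residue basis has the least value of its coefficients:
   divided by a coefficient of least value, it has nonzero residue. *)
have indr (a : 'I_f -> C) : (forall i, K (a i)) -> (exists i, a i != 0) ->
    exists i, [/\ a i != 0, \sum_i a i * val (s i) != 0 & v (\sum_i a i * val (s i)) = v (a i)].
  move=> Ka [i0 ai0]; have [i ai hi] := exists_min (fun i => v (a i)) (P := fun i => a i != 0) ai0.
  have /choice [l hl] : forall j, exists l : vring_of v, val l = a j / a i.
    move=> j; apply: vring_lift; have [->|aj] := eqVneq (a j) 0; first by rewrite mul0r rpred0.
    rewrite vringN0 ?mulf_neq0 ?invr_eq0 // val_div //.
    by rewrite -(vg_leD2 _ _ (v (a i))) addr0 addrC subrK hi.
  have aE : \sum_j a j * val (s j) = a i * val (\sum_j l j * s j).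
    rewrite rmorph_sum mulr_sumr; apply: eq_bigr => j _.
    by rewrite rmorphM /= hl; field.
  set w := \sum_j l j * s j in aE.
  have nw : ~~ small v 0 (val w).
    rewrite -res_small rmorph_sum /=; apply/negP => /eqP rw.
    have := ci (fun j => res v (l j)) _ _ i; rewrite (_ : l i = 1); last first.
      by apply: val_inj; rewrite hl divff // rmorph1.
    rewrite rmorph1 => h; move: (oner_neq0 (residue v)); rewrite h ?eqxx // => [j|].
      by exists (l j) => //=; rewrite hl; apply: (subfield_div hsK).
    rewrite -[RHS]rw; apply: eq_bigr => j _; rewrite rmorphM; congr (_ * _).
    by have [_ _ <-] := hs j.
  have w0 : val w != 0 by apply: contraNneq nw => ->; apply: small0.
  exists i; rewrite aE mulf_neq0 //; split=> //.
  by rewrite valM // (unit_val w0 (valP w) nw) addr0.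
(* The nonzero inner sums times [r j] have values in distinct cosets of the value group of [K], so
   they cannot cancel. *)
have iz (a : 'I_f * 'I_e -> C) : (forall ij, K (a ij)) ->
    \sum_ij a ij * z ij = 0 -> forall ij, a ij = 0.
  move=> Ka; rewrite (eq_bigr (fun ij => a (ij.1, ij.2) * z (ij.1, ij.2))); last by case.
  rewrite -(pair_bigA _ (fun i j => a (i, j) * z (i, j))) exchange_big /=.
  rewrite (eq_bigr (fun j => (\sum_i a (i, j) * val (s i)) * r j)); last first.
    by move=> j _; rewrite mulr_suml; apply: eq_bigr => i _; rewrite mulrA.
  have nz j : (\sum_i a (i, j) * val (s i)) * r j != 0 ->
      exists2 k, value_group K k & v ((\sum_i a (i, j) * val (s i)) * r j) = k + t j.
    rewrite mulf_eq0 negb_or => /andP [s0 r0].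
    have [|i [ai _ e1]] := indr (fun i => a (i, j)) (fun i => Ka (i, j)).
      apply: contrapT => no; move/eqP: s0; apply; apply: big1 => i _.
      have [->|ai] := eqVneq (a (i, j)) 0; first by rewrite mul0r.
      by case: no; exists i.
    exists (v (a (i, j))); first by exists (a (i, j)).
    by rewrite valM // e1; have [_ _ _ ->] := hr j.
  move=> s0 [i j]; have {}s0 : \sum_i a (i, j) * val (s i) = 0.
    have [r0 _ _ _] := hr j; apply/eqP; rewrite -(inj_eq (mulIf r0)) mul0r; apply/eqP.
    apply: (sum_distinct _ s0 j) => j1 j2 /nz [k1 vk1 ->] /nz [k2 vk2 ->] ek.
    have [k [_ un]] := tu _ (tM j1); rewrite -(un j1).
      apply: un; have -> : t j1 - t j2 = k2 - k1.
        by apply/eqP; rewrite subr_eq addrAC -ek addrAC subrr add0r.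
      exact: vgB.
    by rewrite subrr -(subrr k1); apply: vgB.
  apply: contrapT => /eqP aij; have [|i'] := indr (fun i => a (i, j)) (fun i => Ka (i, j)).
    by exists i.
  by move=> [_ /eqP].
(* The number of these independent products is the degree, so they span [M], and all of them are
   fixed by [g]. *)
have card : #|{: 'I_f * 'I_e}| = (e * f)%N by rewrite card_prod !card_ord mulnC.
have [a Ka ->] := basis_independent hsK hd card Mz iz Mx.
rewrite rmorph_sum; apply: eq_bigr => ij _.
by rewrite rmorphM gz (fg _ (Ka ij)).
Qed.

End Tame.

(** * Maximal purely wild extensions *)

Section TrivialValuation.
Variables (C : closedFieldType) (B : set C) (aB : is_algebraic_closure B).
Implicit Types (g : {rmorphism C -> C}).

Definition trivial_valuation : valuation C.
Proof.
refine (@Valuation C int (fun=> 0) _ _ _ _).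
- by move=> x y; apply: le_total.
- by move=> x y z; rewrite lerD2l.
- by move=> x y _ _; rewrite addr0.
- by move=> x y _ _ _; rewrite lexx.
Defined.

Lemma trivial_graded (g : C -> C) x : graded trivial_valuation g x -> g x = x.
Proof. by rewrite /graded /small /= ltxx orbF subr_eq0 => /eqP. Qed.

(** For the trivial valuation, acting trivially on leading terms means fixing; [graded_faithfulS]
    then specialises to Artin's theorem for groups that contain a stabilizer. *)
Lemma artin (s : seq C) (X : set (C -> C)) g : stable B s -> subgroup B X ->
  (forall h : {rmorphism C -> C}, fixes B h -> stabilizer s h -> X h) ->
  fixes B g -> (forall x, invariants B X x -> g x = x) -> X g.
Proof.
move=> st hX sX fg hg.
have v0 (h : {rmorphism C -> C}) : fixes B h -> isometric trivial_valuation h by [].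
apply: (graded_faithfulS aB v0 st hX sX) => // [h fh hh x xs|x /hg]; last exact: graded_fixed.
by apply/trivial_graded/hh => k _; apply.
Qed.

End TrivialValuation.

Section MaximalPurelyWild.
Variables (C : closedFieldType) (v : valuation C) (p : nat).

Lemma max_purely_wild_exists (B M : set C) : purely_wild v p B M ->
  exists2 W, max_purely_wild v p B W & M `<=` W.
Proof.
move=> hM; have [[hB hsM BM] vM rM] := hM.
have [] := @Zorn_bigcup _ (fun X => purely_wild v p B (M `|` X)).
  move=> F FP Ftot; set U := \bigcup_(X in F) X.
  have two x y : (M `|` U) x -> (M `|` U) y ->
      exists X, [/\ purely_wild v p B X, X `<=` M `|` U, X x & X y].
    have sub X : F X -> M `|` X `<=` M `|` U.
      by move=> FX z [|Xz]; [left | right; exists X].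
    move=> [Mx|[X FX Xx]] [My|[Y FY Yy]].
    - by exists M; split=> // z; left.
    - by exists (M `|` Y); split; [apply: FP | apply: sub | left | right].
    - by exists (M `|` X); split; [apply: FP | apply: sub | right | left].
    - have [XY|YX] := Ftot _ _ FX FY.
        exists (M `|` Y); split; [exact: FP | exact: sub | by right; apply: XY | by right].
      by exists (M `|` X); split; [apply: FP | apply: sub | right | right; apply: YX].
  split; first split=> //.
  - split; first by left; apply: (subfield1 hsM).
      move=> x y hx hy; have [X [[[_ hX _] _ _] sX Xx Xy]] := two _ _ hx hy.
      by apply: sX; apply: (subfieldB hX).
    move=> x y hx hy; have [X [[[_ hX _] _ _] sX Xx Xy]] := two _ _ hx hy.
    by apply: sX; apply: (subfield_div hX).
  - by move=> x Bx; left; apply: BM.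
  - move=> _ [x [hx x0] <-]; have [X [[_ vX _] sX Xx _]] := two _ _ hx hx.
    by apply: vX; exists x.
  - move=> _ [x hx <-]; have [X [[_ _ rX] sX Xx _]] := two _ _ hx hx.
    by apply: rX; exists x.
move=> A [pA maxA]; exists (M `|` A); last by left.
split=> // W' pW' WW'; apply/seteqP; split=> // x W'x.
apply: contrapT => nx; apply: (maxA W').
  by split=> [z Az|W'A]; [apply: WW'; right | apply: nx; right; apply: W'A].
suff -> : M `|` W' = W' by [].
by apply/seteqP; split=> [z [Mz|//]|z W'z]; [apply: WW'; left | right].
Qed.

End MaximalPurelyWild.

(** * Characters of order p and non-uniqueness *)

Section Characters.
Variables (C : closedFieldType) (v : valuation C) (p : nat) (hp : p \in [pchar (residue v)]).
Variables (B : set C) (hB : henselian v B).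
Variables (gT : finGroupType) (Q : {group gT}) (cardQ : #|Q| = p).
Implicit Types (chi : (C -> C) -> gT) (g h : {rmorphism C -> C}) (x y : C).

Let aB : is_algebraic_closure B := hB.1.
Let vB g : fixes B g -> isometric v g. Proof. exact: henselian_isometric. Qed.

Definition character chi := (forall g, fixes B g -> chi g \in Q) /\
  forall g h, fixes B g -> fixes B h -> chi (g \o h) = (chi g * chi h)%g.

Definition kernel chi : set (C -> C) := [set g | chi g = 1%g].

Lemma character_id chi : character chi -> chi id = 1%g.
Proof.
move=> [_ M]; have f : fixes B (idfun : {rmorphism C -> C}) by [].
by apply: (mulgI (chi id)); rewrite mulg1 -(M _ _ f f).
Qed.

Lemma subgroup_kernel chi : character chi -> subgroup B (kernel chi).
Proof.
move=> hc; have [cQ cM] := hc; split; first exact: character_id.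
  by move=> g h fg fh; rewrite /kernel /= cM // => -> ->; rewrite mulg1.
rewrite /kernel /= => g h fg fh hK ch; have := cM g h fg fh; rewrite ch mulg1 => <-.
by rewrite -(character_id hc); congr chi; apply/funext => x /=; rewrite hK.
Qed.

Lemma character_eq chi g h x : character chi -> fixes B g -> fixes B h ->
  chi g = chi h -> invariants B (kernel chi) x -> g x = h x.
Proof.
move=> hc fg fh e hx; apply: (invariants_eq aB (subgroup_kernel hc) fg fh hx) => k fk hK.
have [cQ cM] := hc; rewrite /kernel /= cM // e -cM //.
by rewrite -(character_id hc); congr chi; apply/funext => y /=; rewrite hK.
Qed.

(** [chi rho] generates [Q], so each class modulo the kernel has a representative [r q] acting
    trivially on leading terms. The product of the [r q x] is invariant under all automorphisms, so
    a p-power of it lies in [B]; its value is p times [v x], and for integral x its residue is the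
    p-th power of that of x. *)
Lemma wild_kernel chi (rho : {rmorphism C -> C}) : character chi -> fixes B rho -> chi rho != 1%g ->
  (forall x, invariants B (kernel chi) x -> graded v rho x) ->
  purely_wild v p B (invariants B (kernel chi)).
Proof.
move=> hc frho nrho grho; have [cQ cM] := hc; set M := invariants B (kernel chi).
have hsM : subfield M := invariants_subfield _ _.
have prp : prime p := res_char_prime hp.
have Qc q : q \in Q -> exists i, q = (chi rho ^+ i)%g.
  have -> : Q :=: <[chi rho]>%g.
    apply/esym/eqP; rewrite eqEcard cycle_subG cQ //= cardQ.
    have := order_dvdG (cQ _ frho); rewrite cardQ.
    case/primeP: prp => _ /[apply] /orP [|/eqP e]; first by rewrite order_eq1 (negPf nrho).
    by rewrite -/(order (chi rho)) e.
  by move/cycleP.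
have [r hr] : exists r : gT -> {rmorphism C -> C}, forall q, q \in Q ->
    [/\ fixes B (r q), chi (r q) = q & forall x, M x -> graded v (r q) x].
  suff /choice [r hr] : forall q, exists g, q \in Q ->
    [/\ fixes B g, chi g = q & forall x, M x -> graded v g x] by exists r.
  move=> q; have [/Qc [i ->]|_] := boolP (q \in Q); last by exists (idfun : {rmorphism C -> C}).
  suff [g hg] : exists g, [/\ fixes B g, chi g = (chi rho ^+ i)%g
      & forall x, M x -> graded v g x] by exists g.
  elim: i => [|i [g [fg cg gg]]].
    exists (idfun : {rmorphism C -> C}); rewrite expg0; split=> //; first exact: character_id.
    by move=> x _; apply: graded_fixed.
  exists (rho \o g); split; first exact: fixes_comp.
    by rewrite cM // cg expgS.
  by move=> x Mx; apply: graded_comp; [exact: vB | exact: grho | exact: gg].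
have nM x : M x -> forall g, fixes B g ->
    g (\prod_(q in Q) r q x) = \prod_(q in Q) r q x.
  move=> Mx g fg; rewrite rmorph_prod [RHS](reindex_inj (mulgI (chi g))) /=.
  rewrite [RHS](eq_bigl (mem Q)); last by move=> q; rewrite /= groupMl ?cQ.
  apply: eq_bigr => q Qq; have [f1 c1 _] := hr _ Qq.
  have [|f2 c2 _] := hr (chi g * q)%g; first by rewrite groupM ?cQ.
  rewrite -[LHS]/((g \o r q) x); apply: (character_eq hc) Mx => //.
    exact: fixes_comp.
  by rewrite cM // c1 c2.
have nB x : M x -> exists j, B ((\prod_(q in Q) r q x) ^+ (p ^ j)).
  move=> Mx; have [n hn Bn] := fixed_purely_inseparable aB (nM x Mx).
  by have [j nj] := pchar_res_char hp hn; exists j; rewrite -nj.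
split; first by split=> //; [exact: aB.1 | exact: invariants_base].
- move=> _ [x [Mx x0] <-]; have [j Bj] := nB x Mx.
  have rx0 q : r q x != 0 by rewrite fmorph_eq0.
  have N0 : \prod_(q in Q) r q x != 0 by apply/prodf_neq0.
  exists j.+1; exists ((\prod_(q in Q) r q x) ^+ (p ^ j)).
    by split=> //; rewrite expf_neq0.
  rewrite valX // expnS mulrnA; congr (_ *+ _).
  rewrite -big_filter val_prod // big_filter (eq_bigr (fun=> v x)).
    by rewrite sumr_const cardQ.
  by move=> q Qq; have [f _ _] := hr _ Qq; apply: vB.
move=> _ [t Mt <-]; have [j Bj] := nB _ Mt.
have /choice [l hl] : forall q, exists l : vring_of v,
    q \in Q -> val l = r q (val t) /\ res v l = res v t.
  move=> q; have [Qq|_] := boolP (q \in Q); last by exists 0.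
  have [f _ gt] := hr _ Qq.
  have [l le] : exists l : vring_of v, val l = r q (val t).
    by apply: vring_lift; rewrite vring_isometric; [exact: (valP t) | exact: vB].
  exists l => _; split=> //; apply/eqP; rewrite res_eq le.
  by apply: graded_small; [exact: (valP t) | exact: gt].
exists (p ^ j.+1)%N; first exact: pchar_nat_exp.
exists ((\prod_(q in Q) l q) ^+ (p ^ j)).
  change (B (val ((\prod_(q in Q) l q) ^+ (p ^ j)))).
  rewrite rmorphXn rmorph_prod (eq_bigr (fun q => r q (val t))) //.
  by move=> q /hl [].
rewrite resX expnS exprM; congr (_ ^+ _).
rewrite rmorph_prod (eq_bigr (fun=> res v t)); first by rewrite prodr_const cardQ.
by move=> q /hl [].
Qed.

(* With M the field of chi1, M' the field of chi1 / chi2 and F0 the field of chi2,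
   any two of them generate the third. M and M' are purely wild, but a purely
   wild W' containing both would contain F0, on which G acts non-trivially
   on leading terms. As M is Galois, an isomorphism W -> W' puts M into W'. *)
Lemma characters_not_unique chi1 chi2 (s1 s2 : seq C) :
  character chi1 -> character chi2 -> stable B s1 -> stable B s2 ->
  (forall g, fixes B g -> stabilizer s1 g -> kernel chi1 g) ->
  (forall g, fixes B g -> stabilizer s2 g -> kernel chi2 g) ->
  (exists2 g : {rmorphism C -> C}, fixes B g & ~ kernel chi1 g) ->
  (exists2 g : {rmorphism C -> C}, fixes B g & ~ kernel chi2 g) ->
  (forall g x, fixes B g -> invariants B (kernel chi1) x -> graded v g x) ->
  graded_faithful B v (stabilizer s2) ->
  not_unique_max_purely_wild v p B.
Proof.
move=> c1 c2 st1 st2 k1 k2 [g1 fg1 n1] [g2 fg2 n2] gM fs2.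
have [cQ1 cM1] := c1; have [cQ2 cM2] := c2.
(* Otherwise [kernel chi1] contains the stabilizer of [s2] and inherits [graded_faithful] from it;
   as every automorphism acts trivially on the leading terms of M, [chi1] would be trivial. *)
have [rho [frho srho nrho]] : exists rho : {rmorphism C -> C},
    [/\ fixes B rho, stabilizer s2 rho & ~ kernel chi1 rho].
  apply: contrapT => no; apply: n1.
  apply: (graded_faithfulS aB vB st2 (subgroup_kernel c1) _ fs2) => //.
    by move=> g fg sg; apply: contrapT => ng; apply: no; exists g.
  by move=> x; apply: gM.
pose chi3 (g : C -> C) := (chi1 g * (chi2 g)^-1)%g.
have abQ : abelian Q.
  by apply/cyclic_abelian/prime_cyclic; rewrite cardQ; apply: res_char_prime hp.
have comQ a b : a \in Q -> b \in Q -> (a * b = b * a)%g.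
  by move=> Qa Qb; apply: (centsP abQ).
have c3 : character chi3.
  split=> [g fg|g h fg fh]; first by rewrite groupM ?groupV ?cQ1 ?cQ2.
  rewrite /chi3 cM1 // cM2 // invMg -!mulgA; congr (_ * _)%g.
  rewrite [in RHS](comQ (chi2 g)^-1%g) ?groupM ?groupV ?cQ1 ?cQ2 // !mulgA.
  by [].
pose M := invariants B (kernel chi1); pose M' := invariants B (kernel chi3).
have wM : purely_wild v p B M.
  apply: (wild_kernel c1 frho); first by apply/eqP.
  by move=> x; apply: gM.
have wM' : purely_wild v p B M'.
  apply: (wild_kernel c3 frho).
    by rewrite /chi3 (k2 rho frho srho) invg1 mulg1; apply/eqP.
  (* Elements of [kernel chi1] that fix [s2] lie in [kernel chi3], so M' is contained in the
     compositum treated there. *)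
  move=> x Mx; apply: (graded_compositum aB vB st2 fs2 (subgroup_kernel c1) gM) => //.
  apply: invariantsS Mx => g fg [g1' sg].
  by rewrite /kernel /= /chi3 (k2 g fg sg) g1' invg1 mulg1.
have [W hW MW] := max_purely_wild_exists wM.
have [W' hW' MW'] := max_purely_wild_exists wM'.
exists W, W'; split=> // -[s [[sW _ _] sh sB _]].
have [[[_ hsW BW] _ _] _] := hW; have [wW' _] := hW'; have [[_ hsW' BW'] _ _] := wW'.
have [g fg gs] := field_hom_extend aB hsW BW sh sB.
have MW'' : M `<=` W'.
  move=> x Mx; have [h [fh gK hK]] := fixes_inv aB fg.
  suff Mhx : M (h x) by rewrite -(hK x) gs; [apply: sW; apply: MW | apply: MW].
  move=> k fk kk; apply: (fmorph_inj g); rewrite hK.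
  apply: (Mx (g \o (k \o h))); first by do 2 apply: fixes_comp => //.
  rewrite /kernel /= cM1 ?cM1 //; last exact: fixes_comp.
  rewrite (_ : chi1 k = 1%g) // mul1g -cM1 // -(character_id c1).
  by congr chi1; apply/funext => y /=; rewrite hK.
(* Automorphisms over [W'] lie in [kernel chi1] and [kernel chi3], hence in [kernel chi2]. So the
   field of [chi2] is purely inseparable over [W'], and [g2] acts trivially on its leading terms,
   against [n2]. *)
apply: n2; apply: (graded_faithfulS aB vB st2 (subgroup_kernel c2) k2 fs2) => // x Mx.
have fix' h : fixes W' h -> h x = x.
  move=> fW; have fh : fixes B h := fixesS BW' fW; apply: Mx => //.
  have h1 : kernel chi1 h.
    by apply: (artin aB st1 (subgroup_kernel c1) k1) => // y /MW'' /fW.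
  have h3 : kernel chi3 h.
    apply: (artin (s := s1 ++ s2) aB _ (subgroup_kernel c3)) => //.
    - move=> k fk y; rewrite !mem_cat => /orP [ys|ys]; first by rewrite st1.
      by rewrite st2 ?orbT.
    - move=> k fk sk; rewrite /kernel /= /chi3 (k1 k fk) ?(k2 k fk) ?invg1 ?mulg1 //.
        by move=> y ys; apply: sk; rewrite mem_cat ys orbT.
      by move=> y ys; apply: sk; rewrite mem_cat ys.
    by move=> y /MW' /fW.
  apply: invg_inj; apply: (mulgI (chi1 h)); rewrite -/(chi3 h).
  by rewrite [chi3 h]h3 [chi1 h]h1 invg1 mulg1.
have aW' := algebraic_closureS aB hsW' BW'.
have [n hn Wn] := fixed_purely_inseparable aW' fix'.
have [j nj] := pchar_res_char hp hn; rewrite nj in Wn.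
apply: (graded_exp (k := j) hp).
exact: wild_graded hp hB wW' fg2 Wn.
Qed.

End Characters.

(** * Galois groups of compositums *)

Section FiniteSupport.
Variables (C : closedFieldType) (B : set C) (aB : is_algebraic_closure B).
Implicit Types (D U : set C) (l s : seq C) (x y : C) (g h : {rmorphism C -> C}).

(** Stands for membership in a field generated by finitely many elements of [U]; all that is kept is
    that endomorphisms fixing these also fix [x]. *)
Lemma finite_support U x : smallest (@subfield C) U x ->
  exists2 l, {in l, forall u, U u} & forall g, stabilizer l g -> g x = x.
Proof.
pose S := [set y | exists2 l, {in l, forall u, U u} & forall g, stabilizer l g -> g y = y].
have catU l1 l2 : {in l1, forall u, U u} -> {in l2, forall u, U u} ->
    {in l1 ++ l2, forall u, U u}.
  by move=> h1 h2 u; rewrite mem_cat => /orP [/h1|/h2].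
have stl l1 l2 (g : C -> C) : stabilizer (l1 ++ l2) g -> stabilizer l1 g /\ stabilizer l2 g.
  by move=> h; split=> u ul; apply: h; rewrite mem_cat ul ?orbT.
suff sS : smallest (@subfield C) U `<=` S by move/sS.
apply: smallest_sub.
  split; first by exists [::] => // g _; apply: rmorph1.
    move=> y z [l1 U1 h1] [l2 U2 h2]; exists (l1 ++ l2); first exact: catU.
    by move=> g /stl [/h1 e1 /h2 e2]; rewrite rmorphB e1 e2.
  move=> y z [l1 U1 h1] [l2 U2 h2]; exists (l1 ++ l2); first exact: catU.
  by move=> g /stl [/h1 e1 /h2 e2]; rewrite fmorph_div e1 e2.
move=> u Uu; exists [:: u] => [w|g]; first by rewrite inE => /eqP ->.
by apply; rewrite mem_head.
Qed.

Lemma stable_closure l : exists s, [/\ stable B s, {subset l <= s}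
  & {in s, forall y, exists x g, [/\ x \in l, fixes B g & y = g x]}].
Proof.
elim: l => [|x l [s [st sl sc]]]; first by exists [::].
have [r [p [mp _ hr st']]] := conjugates aB x; exists (r ++ s); split.
- by move=> g fg y; rewrite !mem_cat => /orP [/(st' g fg) ->|/(st g fg) ->]; rewrite ?orbT.
- move=> y; rewrite in_cons mem_cat => /orP [/eqP ->|/sl ->]; last by rewrite orbT.
  by rewrite hr; case: mp => _ _ ->.
move=> y; rewrite mem_cat => /orP [|/sc [z [g [zl fg ->]]]]; last first.
  by exists z, g; rewrite in_cons zl orbT.
by rewrite hr => /(fixes_conj aB mp) [g fg <-]; exists x, g; rewrite mem_head.
Qed.

Variables (v : valuation C).
Hypothesis (vB : forall g, fixes B g -> isometric v g).

(** The conclusion of [tame_graded_fixed] for a single element. In this form it passes from [K] to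
    [E] at once, without a proof that F.E|E is tame. *)
Definition rigid u := forall g D, fixes B g -> subfield D -> B `<=` D -> D u ->
  (forall y, D y -> graded v g y) -> g u = u.

(** For a conjugate a(u) of a rigid u, rigidity is applied to a^-1 g a, which again acts trivially
    on the leading terms of the invariants because [a] maps these to themselves. *)
Lemma rigid_faithful l s : {in l, forall u, rigid u} -> stable B s -> {subset l <= s} ->
  {in s, forall y, exists x g, [/\ x \in l, fixes B g & y = g x]} ->
  graded_faithful B v (stabilizer s).
Proof.
move=> rl st ls sl g fg gg y /sl [u [a [ul fa ->]]].
have [b [fb aK bK]] := fixes_inv aB fa.
have fbga : fixes B (b \o (g \o a)) by do 2 apply: fixes_comp => //.
suff : (b \o (g \o a)) u = u by move/(congr1 a); rewrite /= bK.
apply: (rl u ul _ (invariants B (stabilizer s))) => //.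
- exact: invariants_subfield.
- exact: invariants_base.
- by move=> h fh sh; apply/sh/ls.
move=> x hx; have := gg _ (invariants_stable aB st fa hx).
have [->|x0] := eqVneq x 0; first by rewrite graded0.
rewrite /graded /= vB // -(small_isometric _ _ (vB fb)) rmorphB aK.
by [].
Qed.

End FiniteSupport.

Section GaloisRestriction.
Variables (C : closedFieldType) (B : set C) (aB : is_algebraic_closure B).
Implicit Types (D M : set C) (s : seq C) (x y : C) (g h : {rmorphism C -> C}).

(** Follows the encoding of [gal], whose elements are the identity outside the field. *)
Definition restrict D (g : C -> C) : C -> C := fun x => if `[<D x>] then g x else x.

Lemma restrictE D (g : C -> C) x : D x -> restrict D g x = g x.
Proof. by move=> Dx; rewrite /restrict asboolT. Qed.

Lemma restrictN D (g : C -> C) x : ~ D x -> restrict D g x = x.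
Proof. by move=> Dx; rewrite /restrict asboolF. Qed.

Lemma restrict_gal D M g : galois_extension B D -> fixes B g -> M `<=` D ->
  (forall x, M x -> g x = x) -> gal M D (restrict D g).
Proof.
move=> [[_ hD BD] _ nD] fg MD gM; have [h [fh gK hK]] := fixes_inv aB fg.
split.
- split=> [x Dx|x y|y Dy].
  + by rewrite restrictE //; apply: normal_conj nD fg _ Dx.
  + by rewrite !inE => Dx Dy; rewrite !restrictE //; apply: fmorph_inj.
  + have Dhy : D (h y) := normal_conj aB nD fh Dy.
    by exists (h y) => //; rewrite restrictE.
- split; first by rewrite restrictE ?rmorph1 //; apply: (subfield1 hD).
    by move=> x y Dx Dy; rewrite !restrictE ?rmorphD //; apply: (subfieldD hD).
  by move=> x y Dx Dy; rewrite !restrictE ?rmorphM //; apply: (subfieldM hD).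
- by move=> x Mx; rewrite restrictE; [apply: gM | apply: MD].
by move=> x; apply: restrictN.
Qed.

Lemma gal_restrict D (s : C -> C) : galois_extension B D -> gal B D s ->
  exists2 g : {rmorphism C -> C}, fixes B g & s = restrict D g.
Proof.
move=> [[_ hD BD] _ nD] [_ sh sB sN].
have [g fg gs] := field_hom_extend aB hD BD sh sB; exists g => //.
apply/funext => x; have [Dx|nDx] := pselect (D x); first by rewrite restrictE // gs.
by rewrite restrictN // sN.
Qed.

Lemma restrict_comp D g h : galois_extension B D -> fixes B h ->
  restrict D (g \o h) = restrict D g \o restrict D h.
Proof.
move=> [[_ hD BD] _ nD] fh; apply/funext => x /=.
have [Dx|nDx] := pselect (D x); last by rewrite !restrictN.
rewrite (restrictE _ Dx) [restrict D h x]restrictE // restrictE //.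
exact: normal_conj aB nD fh _ Dx.
Qed.

Lemma finite_galois_closure D s : galois_extension B D -> stable B s ->
  {in s, forall x, D x} ->
  exists M, [/\ galois_extension B M, M `<=` D, {in s, forall x, M x} & finite_extension B M].
Proof.
move=> [[hB hD BD] sD nD] st sD'.
have [M [hM BM Ms fM minM]] := finite_generation s hB aB.2.
have MD : M `<=` D by apply: minM.
exists M; split=> //; split=> //; first by move=> x /MD/sD.
move=> x q Mx mq y /(fixes_conj aB mq) [g fg <-].
(* Minimality of M is applied to its preimage under [g], a subfield containing [B] and the stable
   list. *)
suff : M `<=` [set z | M (g z)] by apply.
apply: minM.
- split=> [|z w /= Mz Mw|z w /= Mz Mw]; first by rewrite /= rmorph1; apply: (subfield1 hM).
    by rewrite rmorphB; apply: (subfieldB hM).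
  by rewrite fmorph_div; apply: (subfield_div hM).
- by move=> z Bz /=; rewrite fg //; apply: BM.
by move=> z zs /=; apply/Ms/st.
Qed.

Lemma galois_over D A : galois_extension B D -> subfield A -> B `<=` A -> A `<=` D ->
  galois_extension A D.
Proof.
move=> [[hB hD BD] sD nD] hA BA AD; split=> //.
  by move=> x /sD; apply: separable_elementS.
move=> x q Dx mq y ry; have [r mr] := minpoly_exists hB (aB.2 x).
apply: (nD _ _ Dx mr); have [_ cr rr _] := mr.
have /dvdpP [t ->] : q %| r by apply: (minpoly_dvd hA mq) => // i; apply/BA/cr.
by rewrite rootM ry orbT.
Qed.

End GaloisRestriction.

(** * The core argument common to both cases *)

Section Comparison.
Variables (C : closedFieldType) (v : valuation C) (p : nat) (hp : p \in [pchar (residue v)]).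
Variables (B : set C) (hB : henselian v B).
Implicit Types (A D M : set C) (s : seq C) (x y : C) (g h : {rmorphism C -> C}).

Let aB : is_algebraic_closure B := hB.1.
Let vB g : fixes B g -> isometric v g. Proof. exact: henselian_isometric. Qed.

(* An automorphism of order prime to p that acts trivially on leading terms is
   trivial: the increments along an orbit have the same leading term, so their
   vanishing sum is a unit multiple of each of them. *)
Lemma graded_orbit A g x n : subfield A -> fixes B g -> (forall y, A y -> graded v g y) ->
  (forall i, A (iter i g x)) -> iter n g x = x -> ~~ (p %| n)%N -> g x = x.
Proof.
move=> hA fg gA Ax gn pn.
pose y i := iter i.+1 g x - iter i g x.
have yS i : y i.+1 = g (y i) by rewrite /y rmorphB.
have sy i : small v (v (y 0)) (y i - y 0).
  elim: i => [|i IH]; first by rewrite subrr small0.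
  have -> : y i.+1 - y 0 = (y i.+1 - y i) + (y i - y 0) by rewrite addrA subrK.
  apply: smallD IH; rewrite yS.
  have [y0|y0] := eqVneq (y i) 0; first by rewrite y0 rmorph0 subrr small0.
  have -> : v (y 0) = v (y i).
    elim: i {y0} (y0) => [//|i IH] yi0.
    have yi : y i != 0 by apply: contraNneq yi0 => e; rewrite yS e rmorph0.
    by rewrite yS vB // IH.
  by apply: gA; apply: (subfieldB hA).
have s0 : \sum_(i < n) y i = 0.
  rewrite -(big_mkord xpredT y) telescope_sumr // gn subrr //.
have e : y 0 *+ n = - \sum_(i < n) (y i - y 0).
  by rewrite sumrB s0 sub0r opprK sumr_const card_ord.
have [/eqP|y0] := eqVneq (y 0) 0; first by rewrite subr_eq0 => /eqP.
case/negP: pn; rewrite -(small_nat hp) -(smallM 0 _ y0) addr0 mulr_natr e smallN.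
exact: small_sum.
Qed.

(** [D1] and [D2] stand for L.E and F.E, and [U] for the union of F and E. The list [s1] lies in a
    field [A] on whose leading terms the whole group acts trivially: in case (a) the fixed field of
    the automorphisms over L, in case (b) L.E. *)
Theorem galois_comparison (D1 D2 A U : set C) (s1 : seq C) (theta : (C -> C) -> (C -> C)) :
  galois_extension B D1 -> galois_extension B D2 -> D2 = smallest (@subfield C) U ->
  (forall u, U u -> rigid B v u) -> continuous_gal_iso B D2 D1 theta ->
  subfield A -> B `<=` A -> (forall g x, fixes B g -> A x -> graded v g x) ->
  stable B s1 -> {in s1, forall x, D1 x} -> {in s1, forall x, A x} ->
  (exists2 g : {rmorphism C -> C}, fixes B g & ~ stabilizer s1 g) ->
  not_unique_max_purely_wild v p B.
Proof.
move=> g1 g2 D2E rU [thbij thM thO] hA BA gA st1 s1D s1A [g0 fg0 ng0].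
have pf g : fixes B g -> permutes s1 g by move=> fg; exact: stable_permutes st1 fg.
have resE (g : C -> C) x : x \in s1 -> restrict D1 g x = g x by move=> /s1D; apply: restrictE.
have pr (g : C -> C) : permutes s1 g -> permutes s1 (restrict D1 g).
  move=> [gs gi]; split=> [x xs|x y xs ys]; first by rewrite resE // gs.
  by rewrite /= /restrict !asboolT; [apply: gi | apply: s1D | apply: s1D].
have hT : subgroup B [set: C -> C] by [].
pose Gam := perm_image_as_group (B := B) st1 hT.
have inG g : fixes B g -> seq_perm s1 g \in Gam.
  by move=> fg; apply/perm_imageP; exists g.
have prp : prime p := res_char_prime hp.
(* By Cauchy's theorem it suffices to exclude elements of prime order other than p, and
   [graded_orbit] makes these trivial. *)
have pGam : (p.-group Gam)%g.
  apply/pgroupP => q prq qG; have [w wG wq] := Cauchy prq qG.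
  have [g [fg _ gw]] := perm_imageP _ _ _ wG.
  rewrite inE; apply/negPn/negP => qp.
  suff w1 : w = 1%g by move: prq; rewrite -wq w1 order1.
  rewrite -gw; apply/(seq_perm_id (pf g fg)) => x xs.
  have it i : iter i g x \in s1 by elim: i => //= i; exact: (st1 g fg).
  apply: (graded_orbit (A := A) (n := q) hA fg) => //.
  - by move=> y; apply: gA.
  - by move=> i; apply: s1A.
  - have : (w ^+ q)%g (SeqSub xs) = SeqSub xs by rewrite -wq expg_order perm1.
    move/(congr1 val) => /= ew; rewrite -[RHS]ew permX.
    elim: (q) => [//|m IH]; rewrite !iterS IH -gw (seq_permE _ (pf g fg)).
    by [].
  by rewrite dvdn_prime2 // eq_sym.
have [e1|[H maxH _]] := maximal_exists (sub1G Gam).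
  case: ng0; apply/(seq_perm_id (pf _ fg0))/set1gP.
  by have := inG _ fg0; rewrite -e1.
have nH : (H <| Gam)%g := p_maximal_normal pGam maxH.
have cardQ : #|(Gam / H)%g| = p.
  by rewrite card_quotient ?normal_norm // (p_maximal_index pGam maxH).
pose Q := (Gam / H)%G.
have abQ : abelian Q by apply/cyclic_abelian/prime_cyclic; rewrite cardQ.
have GN : Gam \subset 'N(H)%g := normal_norm nH.
pose chi1 (g : C -> C) := coset H (seq_perm s1 g).
pose chi2 (g : C -> C) := chi1 (theta (restrict D2 g)).
have cQ w : w \in Gam -> coset H w \in Q by move=> wG; apply: mem_quotient.
(* The reversal of products by [seq_perm] disappears in the abelian quotient. *)
have cM w w' : w \in Gam -> w' \in Gam -> coset H (w' * w)%g = (coset H w * coset H w')%g.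
  move=> wG wG'; rewrite morphM ?(fintype.subsetP GN) //.
  by apply: (centsP abQ); apply: cQ.
have th g : fixes B g -> exists2 h : {rmorphism C -> C}, fixes B h
    & theta (restrict D2 g) = restrict D1 h.
  move=> fg; have [thf _ _] := thbij.
  by apply: (gal_restrict aB g1); apply: thf; apply: (restrict_gal aB g2 fg) => //; case: g2 => -[].
have prE g : fixes B g -> seq_perm s1 (restrict D1 g) = seq_perm s1 g.
  move=> fg; apply/eq_seq_perm; [exact/pr/pf | exact: pf |] => x; exact: resE.
have c1 : character B Q chi1.
  split=> [g fg|g h fg fh]; first by apply/cQ/inG.
  by rewrite /chi1 seq_perm_comp; [apply: cM; apply: inG | exact: pf | exact: pf].
have rg g : fixes B g -> gal B D2 (restrict D2 g).
  by move=> fg; apply: (restrict_gal aB g2 fg) => //; case: g2 => -[].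
have c2 : character B Q chi2.
  split=> [g fg|g h fg fh].
    by rewrite /chi2; have [h fh ->] := th g fg; rewrite /chi1 prE //; apply/cQ/inG.
  rewrite /chi2 (restrict_comp aB _ g2 fh) thM; [|exact: rg|exact: rg].
  have [[g' fg' ->] [h' fh' ->]] := (th g fg, th h fh).
  rewrite /chi1 seq_perm_comp; [|exact/pr/pf|exact/pr/pf].
  by rewrite !prE //; apply: cM; apply: inG.
have [gam gamG gamH] : exists2 w, w \in Gam & w \notin H.
  by apply/fintype.subsetPn; rewrite proper_subn // (maxgroupp maxH).
have [ga [fga _ gaE]] := perm_imageP _ _ _ gamG.
have nga : coset H gam <> 1%g.
  by move/coset_idr => h; case/negP: gamH; apply: h; apply: (fintype.subsetP GN).
have [[_ _ BD1] _ _] := g1.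
have gal1 : gal B D1 (restrict D1 ga) by apply: (restrict_gal aB g1 fga).
have [M [gM MD1 s1M fM]] := finite_galois_closure aB g1 st1 s1D.
(* Continuity is applied to the open subgroup fixing [s1]: its preimage contains Gal(D2|M2) for some
   M2 finite over [B]. *)
pose V := [set s | gal B D1 s /\ stabilizer s1 s].
have oV : krull_open B D1 V.
  split=> [s [] //|s [gs ss]]; exists M; split=> // t gt; split.
    have gt' : gal B D1 t.
      case: gt => ? ? tM ?; split=> // x Bx; apply: tM.
      by case: gM => -[_ _ BM] _ _; apply: BM.
    have [s' fs' ->] := gal_restrict aB g1 gs; have [t' ft' ->] := gal_restrict aB g1 gt'.
    rewrite -(restrict_comp aB _ g1 ft').
    by apply: (restrict_gal aB g1 (fixes_comp fs' ft')) => //; apply: fixes_comp.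
  by move=> x xs; have [_ _ tM _] := gt; rewrite /= tM; [exact: ss | exact: s1M].
have [_ oW] := thO V oV.
have rid : restrict D2 (idfun : {rmorphism C -> C}) = id.
  by apply/funext => x; rewrite /restrict; case: ifP.
have [|M2 [gM2 MD2 fM2 hM2]] := oW id.
  have fid : fixes B (idfun : {rmorphism C -> C}) by [].
  have gid : gal B D2 id by rewrite -rid; apply: rg.
  split=> //; split; first by case: thbij => + _ _; apply.
  have [h fh hE] := th _ fid; rewrite rid in hE.
  have hh : theta id = theta id \o theta id := thM _ _ gid gid; rewrite hE in hh.
  rewrite /preimage /= hE => x xs.
  have [hs hi] := pr _ (pf h fh).
  by apply: hi; rewrite ?hs //; have := congr1 (fun k => k x) hh => /= <-.
(* A basis of M2 involves finitely many elements of [U]. Their conjugates form [s2]; an automorphism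
   over [B] fixing [s2] fixes M2, so [chi2] is trivial on it. *)
have [n [b Mb bE]] := fM2.
have /choice [l hl] : forall i, exists l,
    {in l, forall u, U u} /\ forall g, stabilizer l g -> g (b i) = b i.
  move=> i; have [|l lU lf] := @finite_support _ U (b i); last by exists l.
  by rewrite -D2E; apply/MD2/Mb.
have [s2 [st2 ls2 s2c]] := stable_closure aB (flatten [seq l i | i <- enum 'I_n]).
have k2 g : fixes B g -> stabilizer s2 g -> kernel chi2 g.
  move=> fg sg; have gb i : g (b i) = b i.
    have [_] := hl i; apply => u ul; apply/sg/ls2/flattenP.
    by exists (l i) => //; apply: map_f; rewrite mem_enum.
  have gM2' x : M2 x -> g x = x.
    move=> /bE [c [[Bc ->] _]]; rewrite rmorph_sum; apply: eq_bigr => i _.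
    by rewrite rmorphM gb (fg _ (Bc i)).
  have [_ [_ sth]] := hM2 _ (restrict_gal aB g2 fg MD2 gM2').
  rewrite /kernel /= /chi2 /chi1.
  have [h fh hE] := th g fg; rewrite [id \o _]/(restrict D2 g) hE in sth *.
  have /(seq_perm_id (pr _ (pf h fh))) -> := sth.
  exact: morph1.
have k1 g : fixes B g -> stabilizer s1 g -> kernel chi1 g.
  by move=> fg /(seq_perm_id (pf g fg)) e; rewrite /kernel /= /chi1 e; apply: morph1.
apply: (characters_not_unique hp hB cardQ c1 c2 st1 st2 k1 k2).
- by exists ga; rewrite // /kernel /= /chi1 gaE.
- have [_ _ /(_ _ gal1) [s gs sE]] := thbij.
  have [g fg gE] := gal_restrict aB g2 gs; exists g => //.
  by rewrite /kernel /= /chi2 -gE sE /chi1 prE // gaE.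
(* Automorphisms over [A] fix [s1], so the invariants of [kernel chi1] are purely inseparable over
   [A]. *)
- move=> g x fg hx; have hA' := algebraic_closureS aB hA BA.
  have [|m hm Am] := @fixed_purely_inseparable _ A x hA'.
    move=> h fh; apply: hx; first exact: (fixesS BA).
    by apply: k1; [exact: (fixesS BA) | move=> y /s1A /fh].
  have [j mj] := pchar_res_char hp hm; rewrite mj in Am.
  by apply: (graded_exp (k := j) hp); apply: gA.
apply: (rigid_faithful aB vB _ st2 ls2 s2c) => u /flattenP [r /mapP [i _ ->] ul].
by apply: rU; case: (hl i) => h _; apply: h.
Qed.

End Comparison.

(** * The two cases of the theorem *)

Lemma separable_moved (C : closedFieldType) (A : set C) (x : C) : is_algebraic_closure A ->
  separable_element A x -> ~ A x -> exists2 g : {rmorphism C -> C}, fixes A g & g x <> x.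
Proof.
move=> aA [q [[_ cq rq _] sq]] nAx; apply: contrapT => no; apply: nAx.
apply: (fixed_simple_root aA _ cq rq) => [g fg|].
  by apply: contrapT => gx; apply: no; exists g.
by rewrite separable_poly.unlock in sq; apply: coprimep_root sq rq.
Qed.

Lemma subgroup_fixes (C : closedFieldType) (K L : set C) : is_algebraic_closure K ->
  subgroup K [set g | fixes L g].
Proof.
move=> aK; split=> [x //|g h _ _ gL hL x Lx /=|g h _ _ hK hL x Lx /=].
  by rewrite hL // gL.
by rewrite -{1}(hL x Lx) hK.
Qed.

Theorem theorem1p7 (Kac : closedFieldType) (nu : valuation Kac)
    (K L F E : set Kac) (p : nat) (theta : (Kac -> Kac) -> (Kac -> Kac)) :
  henselian nu K ->
  p \in [pchar (residue nu)] ->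
  separable_extension K L -> L <> K -> purely_wild nu p K L ->
  F <> K -> tame nu p K F ->
  abelian_galois K E -> tame nu p K E ->
  galois_extension K (compositum L E) ->
  galois_extension K (compositum F E) ->
  continuous_gal_iso K (compositum F E) (compositum L E) theta ->
  continuous_gal_iso E (compositum F E) (compositum L E) theta ->
  forall LEab : set Kac, max_abelian K (compositum L E) LEab ->
  (E `<` LEab \/ E = LEab) /\
  (E `<` LEab -> not_unique_max_purely_wild nu p K) /\
  (E = LEab -> not_unique_max_purely_wild nu p E).
Proof.
move=> hK hp sepL LK wL FK tF abE tE gLE gFE isoK isoE LEab [abD DLE maxD].
have aK : is_algebraic_closure K := hK.1; have hsK : subfield K := aK.1.
have [[_ hL KL] _ _] := wL; have [[_ hE KE] _] := tE; have [gE _] := abE.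
have [gD comD] := abD; have [[_ hD KD] sD nD] := gD; have [_ sepE nE] := gE.
have LE_L : L `<=` compositum L E by move=> x Lx; apply: sub_gen_smallest; left.
have LE_E : E `<=` compositum L E by move=> x Ex; apply: sub_gen_smallest; right.
have FE_E : E `<=` compositum F E by move=> x Ex; apply: sub_gen_smallest; right.
have ED : E `<=` LEab by apply: maxD.
have vK (g : {rmorphism Kac -> Kac}) : fixes K g -> isometric nu g.
  exact: henselian_isometric.
pose XL := [set g : Kac -> Kac | fixes L g].
have sgXL : subgroup K XL := subgroup_fixes L aK.
(* [A] is the purely inseparable closure of [L]. *)
pose A := invariants K XL; have hA : subfield A := invariants_subfield K XL.
have LA : L `<=` A by move=> x Lx g _; apply.
have gA (g : {rmorphism Kac -> Kac}) x : fixes K g -> A x -> graded nu g x.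
  move=> fg Ax; have aL := algebraic_closureS aK hL KL.
  have [|n hn Ln] := @fixed_purely_inseparable _ L x aL.
    by move=> h fh; apply: Ax => //; apply: fixesS KL fh.
  have [j nj] := pchar_res_char hp hn; rewrite nj in Ln.
  by apply: (graded_exp (k := j) hp); apply: wild_graded hp hK wL fg Ln.
have rigidF u : (F `|` E) u -> rigid K nu u.
  move=> [Fu|Eu] g D fg hD' KD' Du gD'.
    exact: (tame_graded_fixed hp hK tF Fu fg hD' KD' Du gD').
  exact: (tame_graded_fixed hp hK tE Eu fg hD' KD' Du gD').
have fixL (h : {rmorphism Kac -> Kac}) : fixes L h -> fixes K h by apply: fixesS.
split; first by have [DE|nDE] := pselect (LEab `<=` E); [right; apply/seteqP | left].
split=> [[_ nDE]|_].
  have [x Dx nEx] : exists2 x, LEab x & ~ E x.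
    by apply: contrapT => no; apply: nDE => x Dx; apply: contrapT => nEx; apply: no; exists x.
  have aE := algebraic_closureS aK hE KE.
  have [rho frE rx] := separable_moved aE (separable_elementS hsK hE KE (sD x Dx)) nEx.
  have frho : fixes K rho := fixesS KE frE.
  have [l lU lx] := finite_support (DLE x Dx).
  (* [s] contains [x] and those of its generators that lie in [E]; the remaining ones lie in [L]. *)
  have [s [st ls sc]] := stable_closure aK (x :: [seq u <- l | `[<E u>]]).
  have sDs : {in s, forall y, LEab y}.
    move=> _ /sc [u [g [ul fg ->]]]; apply: (normal_conj aK nD fg).
    move: ul; rewrite in_cons => /orP [/eqP -> //|].
    by rewrite mem_filter => /andP [/asboolP /ED].
  (* If all elements of [A] in [LEab] were fixed by the whole group, then by Artin's theorem [rho]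
     would agree on [s] with some k over [L]. This k fixes the generators of [x] in [L], and also
     those in [E] because [rho] does; so [rho] would fix [x]. *)
  have [y [Ay Dy [g0 fg0 gy]]] : exists y, [/\ A y, LEab y
      & exists2 g : {rmorphism Kac -> Kac}, fixes K g & g y <> y].
    apply: contrapT => no.
    pose X := [set h : Kac -> Kac | exists2 k : {rmorphism Kac -> Kac}, fixes L k & {in s, h =1 k}].
    have hX : subgroup K X.
      split; first by exists (idfun : {rmorphism Kac -> Kac}).
        move=> g h _ _ [k kL gk] [k' kL' hk']; exists (k \o k').
          exact: fixes_comp.
        by move=> z zs /=; rewrite hk' // gk //; apply: st => //; apply: fixL.
      move=> g h _ _ hK' [k kL hk]; have [k' [fk' kK k'K]] := fixes_inv aK (fixL k kL).
      exists k' => [z Lz|z zs]; first by rewrite -{1}(kL z Lz) kK.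
      by rewrite -{1}(k'K z) -hk ?hK' //; apply: st.
    have [k kL rk] : X rho.
      apply: (artin aK st hX) => // [h fh sh|z hz].
        by exists (idfun : {rmorphism Kac -> Kac}).
      (* Automorphisms fixing [s] belong to [X], so an invariant of [X] has a p-power in K(s),
         inside [LEab]; this power also lies in [A]. *)
      have [M [hM KM sM _ minM]] := finite_generation s hsK aK.2.
      have [|n hn Mn] := @fixed_purely_inseparable _ M z (algebraic_closureS aK hM KM).
        move=> h fh; apply: hz; first exact: fixesS KM fh.
        by exists (idfun : {rmorphism Kac -> Kac}) => // w /sM /fh.
      have Dn : LEab (z ^+ n) by apply: (minM _ hD KD sDs).
      have An : A (z ^+ n).
        move=> h fh hL'; rewrite rmorphXn (hz h fh) //.
        by exists h.
      have rn : rho (z ^+ n) = z ^+ n.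
        by apply: contrapT => rz; apply: no; exists (z ^+ n); split=> //; exists rho.
      apply/eqP; rewrite -subr_eq0; have := exprB_pchar (rho z) z hn.
      by rewrite -rmorphXn rn subrr => /eqP; rewrite expf_eq0 => /andP [].
    apply: rx; rewrite rk ?ls ?mem_head //; apply: lx => u ul.
    have [Lu|Eu] := lU u ul; first exact: kL.
    rewrite -rk ?frE // ls // in_cons mem_filter ul andbT asboolT ?orbT //.
  have [s1 [q [mq us1 s1E st1]]] := conjugates aK y.
  have ys1 : y \in s1 by rewrite s1E; case: mq.
  have s1c w : w \in s1 -> exists2 g : {rmorphism Kac -> Kac}, fixes K g & g y = w.
    by rewrite s1E => rw; apply: (fixes_conj aK mq rw).
  have s1D : {in s1, forall w, LEab w}.
    by move=> w /s1c [g fg <-]; apply: (normal_conj aK nD fg).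
  apply: (galois_comparison hp hK gLE gFE (erefl _) rigidF isoK hA _ gA st1).
  - exact: invariants_base.
  - by move=> w /s1D /DLE.
  (* As Gal(LEab|K) is abelian, conjugates of [y] stay fixed under automorphisms over [L]. *)
  - move=> w /s1c [g fg <-] h fh hL'.
    have := comD _ _ (restrict_gal aK gD fg KD fg) (restrict_gal aK gD fh KD fh).
    move/(congr1 (fun t : Kac -> Kac => t y)) => /=.
    rewrite !(restrictE _ Dy) (Ay h fh hL') !restrictE //; last exact: (normal_conj aK nD fg).
  by exists g0 => // /(_ y ys1).
have hensE := henselianS hK hE KE; have aE := hensE.1.
have gLE' := galois_over aK gLE hE KE LE_E; have gFE' := galois_over aK gFE hE KE FE_E.
have [[_ hLE _] _ nLE] := gLE.
(* An element of [L] outside [K] is moved over [K]. It cannot lie in [E]: there it would be rigid,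
   and fixed since the group acts trivially on the leading terms of [A]. Being separable, it is then
   moved over [E] too. *)
have [l Ll [g0 fg0 gl]] : exists2 l, L l
    & exists2 g : {rmorphism Kac -> Kac}, fixes E g & g l <> l.
  apply: contrapT => no; apply: LK; apply/seteqP; split=> // x Lx.
  apply: contrapT => nKx; have [g fg gx] := separable_moved aK (sepL x Lx) nKx.
  have [Ex|nEx] := pselect (E x).
    apply: gx; apply: (rigidF x (or_intror Ex) g A fg hA) => //.
    - exact: invariants_base.
    - exact: LA.
    by move=> y; apply: gA.
  have [h fh hx] := separable_moved aE (separable_elementS hsK hE KE (sepL x Lx)) nEx.
  by apply: no; exists x => //; exists h.
have [s1 [q [mq us1 s1E st1]]] := conjugates aK l.
have ls1 : l \in s1 by rewrite s1E; case: mq.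
have s1LE : {in s1, forall w, compositum L E w}.
  move=> w; rewrite s1E => rw; have [g fg <-] := fixes_conj aK mq rw.
  by apply: (normal_conj aK nLE fg); apply: LE_L.
apply: (galois_comparison hp hensE gLE' gFE' (erefl _) (U := F `|` E) _ isoE hLE LE_E
  _ _ s1LE s1LE); last by exists g0 => // /(_ l ls1).
- move=> u /rigidF ru g D fg hD' ED' Du; apply: ru => //; first exact: fixesS KE fg.
  exact: subset_trans KE ED'.
(* The compositum lemma is used with a stable list in [E] containing those generators of [x] that
   come from [E]. *)
- move=> g x fg /finite_support [m mU mx].
  have [s [st ls sc]] := stable_closure aK [seq u <- m | `[<E u>]].
  have mE u : u \in [seq u <- m | `[<E u>]] -> E u by rewrite mem_filter => /andP [/asboolP].
  have sE : {in s, forall y, E y}.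
    by move=> _ /sc [u [h [/mE Eu fh ->]]]; apply: (normal_conj aK nE fh).
  apply: (graded_compositum aK vK st _ sgXL gA (fixesS KE fg)).
  - by apply: (rigid_faithful aK vK _ st ls sc) => u /mE Eu; apply: rigidF; right.
  - by move=> y /sE /fg.
  move=> h fh [hL' hs]; apply: mx => u um; have [Lu|Eu] := mU u um; first exact: hL'.
  by apply/hs/ls; rewrite mem_filter um asboolT.
by move=> g fg; apply: st1; apply: fixesS KE fg.
Qed.
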